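(* Let $\mathcal{A}\in\mathbb{C}^{n\times n\times p}$, let $f$ be analytic on a region containing the spectrum of $\mathrm{bcirc}(\mathcal{A})$, and let $K_1:=K_f(\mathcal{A})\in\mathbb{C}^{n^2p\times n^2p}$ and $K_2:=K_f(\mathrm{bcirc}(\mathcal{A}))\in\mathbb{C}^{n^2p^2\times n^2p^2}$ denote the Kronecker forms of the Fréchet derivatives of the t-function $f(\mathcal{A})$ and of the matrix function $f(\mathrm{bcirc}(\mathcal{A}))$, respectively. Let $i,j\in\{1,\dots,n\}$, $k\in\{1,\dots,p\}$ and $c:=i+(k-1)n+(j-1)np$. Then $$K_1(:,c)=\sum_{\alpha=1}^{p}K_2(1:n^2p,\;c+s_\alpha),$$ where $$s_\alpha=\begin{cases}0,&\text{if }\alpha=1,\\ s_{\alpha-1}+n^2p-np+n,&\text{if }\alpha=p-k+2,\\ s_{\alpha-1}+n^2p+n,&\text{otherwise,}\end{cases}$$ the first case taking precedence for $\alpha=1$.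
   Context: For a tensor $\mathcal{A}\in\mathbb{C}^{n\times m\times p}$ with frontal slices $A^{(1)},\dots,A^{(p)}\in\mathbb{C}^{n\times m}$, $\mathrm{unfold}(\mathcal{A})\in\mathbb{C}^{np\times m}$ is the block column with blocks $A^{(1)},\dots,A^{(p)}$, and $\mathrm{fold}$ is its inverse. $\mathrm{bcirc}(\mathcal{A})$ is the block circulant matrix whose first block column is $\mathrm{unfold}(\mathcal{A})$, i.e. its $(r,s)$ block is $A^{(((r-s)\bmod p)+1)}$. The t-function is $f(\mathcal{A}):=\mathrm{fold}(f(\mathrm{bcirc}(\mathcal{A}))\boldsymbol{E}_1)$, with $\boldsymbol{E}_1=\boldsymbol{e}_1\otimes I_n\in\mathbb{C}^{np\times n}$ and $f(\mathrm{bcirc}(\mathcal{A}))$ the usual matrix function. For matrix functions and t-functions, $L_f(X,\cdot)$ is the Fréchet derivative at $X$: the linear map with $f(X+E)-f(X)=L_f(X,E)+o(\|E\|)$. For a matrix, $\mathrm{vec}$ stacks columns; for a tensor $\mathcal{X}\in\mathbb{C}^{n\times n\times p}$, $\mathrm{vec}(\mathcal{X})=\mathrm{vec}(\mathrm{unfold}(\mathcal{X}))$, so entry $(i,j,k)$ sits at position $i+(k-1)n+(j-1)np$. The Kronecker form of the t-Fréchet derivative is the matrix $K_f(\mathcal{A})$ with $\mathrm{vec}(L_f(\mathcal{A},\mathcal{C}))=K_f(\mathcal{A})\,\mathrm{vec}(\mathcal{C})$ for all $\mathcal{C}$; that of the matrix function is the matrix $K_f(M)$ with $\mathrm{vec}(L_f(M,C))=K_f(M)\,\mathrm{vec}(C)$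 for all $C\in\mathbb{C}^{np\times np}$, where $M=\mathrm{bcirc}(\mathcal{A})$. $K(a:b,c)$ denotes entries $a$ through $b$ of column $c$ of $K$, and $K(:,c)$ the whole column. *)

(* Defs.v *)
From HB Require Import structures.
From mathcomp Require Import all_boot all_order all_algebra.
From mathcomp Require Import complex mxtens.
From mathcomp Require Import boolp classical_sets reals topology normedtype.
From mathcomp Require Import sequences derive.

Set Implicit Arguments.
Unset Strict Implicit.
Unset Printing Implicit Defensive.

Import Order.TTheory GRing.Theory Num.Theory numFieldNormedType.Exports.

Local Open Scope classical_set_scope.
Local Open Scope ring_scope.

(* Typing R[i] as a numClosedFieldType lets numFieldNormedType equip it, and
   the matrices over it, with their complex normed-space structure. *)
Definition cplx (R : realType) : numClosedFieldType := R[i].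

(* All ordinals below count from 0.  A position x : 'I_(a * b) is read as the
   pair mxtens_unindex x = (x %/ b, x %% b) : block index, index in the block. *)

Section Tensors.
Variable K : numFieldType.

(* A tensor is represented by its unfolding (block column of its frontal
   slices); unfold and fold are therefore identities, and the norm is the
   largest modulus of an entry. *)
Definition tensor (n m p : nat) := 'M[K]_(p * n, m).

Definition frontal n m p (A : tensor n m p) (k : 'I_p) : 'M[K]_(n, m) :=
  \matrix_(i, j) A (mxtens_index (k, i)) j.

Definition ord_submod p (r s : 'I_p) : 'I_p :=
  Ordinal (ltn_pmod (r + (p - s)) (leq_ltn_trans (leq0n r) (ltn_ord r))).

Definition bcirc n m p (A : tensor n m p) : 'M[K]_(p * n, p * m) :=
  \matrix_(x, y)
    frontal A (ord_submod (mxtens_unindex x).1 (mxtens_unindex y).1)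
      (mxtens_unindex x).2 (mxtens_unindex y).2.

(* e_1 (x) I_n *)
Definition E1 n p : 'M[K]_(p * n, n) :=
  \matrix_(x, j)
    ((val (mxtens_unindex x).1 == 0%N) && ((mxtens_unindex x).2 == j))%:R.

(* Column stacking; on a tensor this is vec (unfold X). *)
Definition vec a b (X : 'M[K]_(a, b)) : 'cV[K]_(b * a) :=
  \col_x X (mxtens_unindex x).2 (mxtens_unindex x).1.

(* Entry (a, c) of M, with a and c counted from 1; 0 outside the matrix. *)
Definition entry m n (M : 'M[K]_(m, n)) (a c : nat) : K :=
  match a, c with
  | a'.+1, c'.+1 =>
      match insub a' : option 'I_m, insub c' : option 'I_n with
      | Some x, Some y => M x y
      | _, _ => 0
      end
  | _, _ => 0
  end.

End Tensors.

Section Functions.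
Variable R : realType.
Local Notation C := (cplx R).

Definition analytic_on (Omega : set C) (f : C -> C) : Prop :=
  forall w, Omega w -> exists a : nat -> C,
    \forall z \near w, series (fun k => a k * (z - w) ^+ k) @ \oo --> f z.

(* q is the Hermite interpolation polynomial of f on the spectrum of M: the
   order at z is the multiplicity of z in the minimal polynomial, i.e. the size
   of the largest Jordan block for z (0 if z is not an eigenvalue). *)
Definition hermite_interpolant (f : C -> C) N (M : 'M[C]_N.+1)
    (q : {poly C}) : Prop :=
  (size q < size (mxminpoly M))%N /\
  forall (z : C) (k : nat), (k < mup z (mxminpoly M))%N ->
    (derivn k q).[z] = derive1n k f z.

(* The primary matrix function f(M) = q(M); the polynomial 0 stands in where
   no interpolant exists, and f(M) is the empty matrix when N = 0. *)
Definition matfun (f : C -> C) N : 'M[C]_N -> 'M[C]_N :=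
  match N with
  | 0 => fun M => M
  | N'.+1 => fun M => horner_mx M (xget 0 [set q | hermite_interpolant f M q])
  end.

Definition tfun (f : C -> C) n p (A : tensor C n n p) : tensor C n n p :=
  matfun f (bcirc A) *m E1 C n p.

(* 'd F X is the Frechet derivative of F at X for the complex norm. *)
Definition kronecker_form a b (F : 'M[C]_(a, b) -> 'M[C]_(a, b))
    (X : 'M[C]_(a, b)) (Kf : 'M[C]_(b * a)) : Prop :=
  forall E, vec ('d F X E) = Kf *m vec E.

End Functions.

(* s_alpha for alpha >= 1 (the value at 0 is a placeholder).  For k <= p and
   1 <= n none of the truncated subtractions truncates. *)
Fixpoint col_shift (n p k alpha : nat) : nat :=
  match alpha with
  | 0 => 0
  | alpha'.+1 =>
      if alpha' == 0 then 0
      else if alpha == p - k + 2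
           then col_shift n p k alpha' + n ^ 2 * p - n * p + n
           else col_shift n p k alpha' + n ^ 2 * p + n
  end%N.

(* Main.v *)
Require Import Defs.
From HB Require Import structures.
From mathcomp Require Import all_boot all_order all_algebra.
From mathcomp Require Import complex mxtens.
From mathcomp Require Import boolp classical_sets reals topology normedtype.
From mathcomp Require Import sequences derive.
From mathcomp Require Import functions interval_inference landau.
From mathcomp Require Import ring lra zify.

Set Implicit Arguments.
Unset Strict Implicit.
Unset Printing Implicit Defensive.

Import Order.TTheory GRing.Theory Num.Theory numFieldNormedType.Exports.

Local Open Scope classical_set_scope.
Local Open Scope ring_scope.

(** The block circulant map and multiplication by [E1] are linear, so the chain
    rule gives [L_f(A, C) = L_f(bcirc A, bcirc C) *m E1] for the Frechet
    derivatives. If [C] is the unit tensor at [(i, j, k)], then [bcirc C] is the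
    sum of [p] unit matrices, one in each block column, and the columns of the
    Kronecker form of the matrix function at their positions are those with the
    indices [c + s_alpha]: moving one block column to the right and, cyclically,
    one block row down adds [n ^ 2 * p + n] to the index, or [n * p] less when
    the block row wraps around. Multiplication by [E1] selects the first block
    column, that is the first [n ^ 2 * p] entries of the vectorized derivative.
    This part is carried by [bcirc_delta], [mulmx_E1] and [col_shift_closed].

    The chain rule needs the matrix function to be Frechet differentiable at
    [bcirc A], and this takes most of the file. Matrix functions are
    defined by Hermite interpolation at the spectrum of each matrix separately,
    so one has to control the interpolation polynomial at a matrix [X] close to
    a given [M], where the eigenvalues of [M] split into clusters. Contour
    integrals are replaced by power series around the eigenvalues of [M], normed
    by the weighted sum of the moduli of their coefficients. Dividing
    [g z - g lam] by [z - lam] costs a factor of order [1 / r] in this norm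
    ([divide]), on discs of radius [r]; iterating over the eigenvalues of [X]
    gives the Newton interpolation polynomial of [g] with a bound for its value
    at [X] ([newton]). The derivatives prescribed by the Hermite conditions are
    read off from the resulting factorization of the error
    ([derive1n_interpolant]), so the Newton polynomial does compute the matrix
    function ([matfun_interpolant]).

    Now let [q] interpolate [f] at the spectrum of [M] to a high order and apply
    this to [g = f - q], which is very small on small discs. As the eigenvalues
    of [X] lie within [O(t ^ (1 / N))] of those of [M], where [t] is the distance
    from [X] to [M] and [N] the size of the matrices, a suitable choice of [r]
    gives [f(X) = q(X) + O(t ^ 2)] ([matfun_near]). So [f] has the
    same derivative at [M] as the polynomial [q], and polynomials are
    differentiable. *)

(** * Real-valued norms and limits over the complex numbers *)

Section RealNorm.
Variable R : realType.
Local Notation C := (cplx R).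

Definition toC (x : R) : C := real_complex R x.

(** The norm of a complex normed module is itself a complex number, and complex
    numbers are only partially ordered; its real part carries the same
    information and lives in a totally ordered field. *)
Definition rnorm (V : normedZmodType C) (x : V) : R := complex.Re (`|x| : C).

Lemma toC_le x y : (toC x <= toC y) = (x <= y). Proof. exact: lecR. Qed.
Lemma toC_lt x y : (toC x < toC y) = (x < y). Proof. exact: ltcR. Qed.
Lemma toCD x y : toC (x + y) = toC x + toC y. Proof. exact: rmorphD. Qed.
Lemma toCM x y : toC (x * y) = toC x * toC y. Proof. exact: rmorphM. Qed.
Lemma toC_inj : injective toC. Proof. exact: complexI. Qed.
Lemma toC0 : toC 0 = 0. Proof. by []. Qed.

Lemma normE (V : normedZmodType C) (x : V) : `|x| = toC (rnorm x).
Proof.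
rewrite /rnorm /toC; apply/esym/(@RRe_real R); exact: (@normr_real C).
Qed.

Lemma rnorm_le (V : normedZmodType C) (x : V) e : (rnorm x <= e) = (`|x| <= toC e).
Proof. by rewrite normE toC_le. Qed.

Lemma rnorm_lt (V : normedZmodType C) (x : V) e : (rnorm x < e) = (`|x| < toC e).
Proof. by rewrite normE toC_lt. Qed.

Lemma rnorm_ge0 (V : normedZmodType C) (x : V) : 0 <= rnorm x.
Proof. by rewrite -toC_le -normE normr_ge0. Qed.

Lemma rnorm0 (V : normedZmodType C) : rnorm (0 : V) = 0.
Proof. by rewrite /rnorm normr0. Qed.

Lemma rnorm_eq0 (V : normedZmodType C) (x : V) : (rnorm x == 0) = (x == 0).
Proof. by rewrite -(inj_eq toC_inj) -normE toC0 normr_eq0. Qed.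

Lemma rnorm_gt0 (V : normedZmodType C) (x : V) : (0 < rnorm x) = (x != 0).
Proof. by rewrite lt_def rnorm_ge0 andbT rnorm_eq0. Qed.

Lemma rnormD (V : normedZmodType C) (x y : V) : rnorm (x + y) <= rnorm x + rnorm y.
Proof. by rewrite rnorm_le toCD -!normE ler_normD. Qed.

Lemma rnormN (V : normedZmodType C) (x : V) : rnorm (- x) = rnorm x.
Proof. by rewrite /rnorm normrN. Qed.

Lemma rnormB (V : normedZmodType C) (x y : V) : rnorm (x - y) <= rnorm x + rnorm y.
Proof. by rewrite -[rnorm y]rnormN; apply: rnormD. Qed.

Lemma rnorm_sum (V : normedZmodType C) I (r : seq I) (P : pred I) (F : I -> V) :
  rnorm (\sum_(i <- r | P i) F i) <= \sum_(i <- r | P i) rnorm (F i).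
Proof.
elim/big_ind2: _ => [|x1 y1 x2 y2 h1 h2|//]; first by rewrite rnorm0.
by apply: (le_trans (rnormD _ _)); rewrite lerD.
Qed.

Lemma rnormM (x y : C) : rnorm (x * y) = rnorm x * rnorm y.
Proof. by apply: toC_inj; rewrite toCM -!normE normrM. Qed.

Lemma rnorm1 : rnorm (1 : C) = 1.
Proof. by apply: toC_inj; rewrite -normE normr1. Qed.

Lemma rnormX (x : C) n : rnorm (x ^+ n) = rnorm x ^+ n.
Proof. by elim: n => [|n IH]; rewrite ?expr0 ?rnorm1 // !exprS rnormM IH. Qed.

Lemma rnorm_nat n : rnorm (n%:R : C) = n%:R.
Proof. by apply: toC_inj; rewrite -normE normr_nat /toC rmorph_nat. Qed.

Lemma rnorm_toC (x : R) : 0 <= x -> rnorm (toC x) = x.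
Proof.
by move=> x0; apply: toC_inj; rewrite -normE ger0_norm // -toC0 toC_le.
Qed.

Lemma rnormCE (z : C) :
  rnorm z = Num.sqrt (complex.Re (z : R[i]) ^+ 2 + complex.Im (z : R[i]) ^+ 2).
Proof. by apply: toC_inj; rewrite -normE; exact: normc_def. Qed.

Lemma rnormZ (V : normedModType C) (a : C) (x : V) : rnorm (a *: x) = rnorm a * rnorm x.
Proof. by apply: toC_inj; rewrite toCM -!normE normrZ. Qed.

Lemma posC_toC (e : C) : 0 < e -> exists2 e' : R, 0 < e' & e = toC e'.
Proof.
move=> e0; have e_real : e \is Num.real by apply: gtr0_real.
have ee : e = toC (complex.Re e) by rewrite /toC [RHS](@RRe_real R).
by exists (complex.Re e) => //; rewrite -toC_lt -ee.
Qed.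

Lemma nbhs_rnormP (V : normedModType C) (x : V) (P : set V) :
  nbhs x P <-> exists2 e : R, 0 < e & forall y, rnorm (y - x) < e -> P y.
Proof.
split=> [/nbhs_ballP[e /= e0 h]|[e e0 h]].
  have [e' e'0 ee'] := posC_toC e0.
  exists e' => // y hy; apply: h; rewrite -ball_normE /= -normrN opprB ee'.
  by rewrite -rnorm_lt.
apply/nbhs_ballP; exists (toC e) => /=; first by rewrite -toC0 toC_lt.
by move=> y; rewrite -ball_normE /= -normrN opprB -rnorm_lt; apply: h.
Qed.

Lemma cvg_rnormP (V : normedModType C) T (F : set_system T) {FF : Filter F} (u : T -> V) s :
  u @ F --> s <-> forall e : R, 0 < e -> \forall n \near F, rnorm (u n - s) < e.
Proof.
split=> [us e e0|us P /nbhs_rnormP[e e0 h]].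
  by apply: (us [set y | rnorm (y - s) < e]); apply/nbhs_rnormP; exists e.
by apply: filterS (us e e0) => n; apply: h.
Qed.

Lemma cvg_rnorm_le (V : normedModType C) T (F : set_system T) {FF : ProperFilter F}
  (u : T -> V) s (B : R) :
  u @ F --> s -> (\forall n \near F, rnorm (u n) <= B) -> rnorm s <= B.
Proof.
move=> /cvg_rnormP us uB; apply/ler_addgt0Pr => e e0.
have [n [h1 h2]] := filter_ex (filterI (us e e0) uB).
have {1}-> : s = u n - (u n - s) by rewrite opprB addrC subrK.
by apply: (le_trans (rnormB _ _)); rewrite lerD // ltW.
Qed.

Lemma cvg_eqn (u v : nat -> C) (s : C) : (forall n, u n = v n) ->
  u n @[n --> \oo] --> s -> v n @[n --> \oo] --> s.
Proof. by move=> /funext ->. Qed.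

Lemma cvg_lim_eq (u : nat -> C) (s t : C) :
  u n @[n --> \oo] --> s -> u n @[n --> \oo] --> t -> s = t.
Proof. by move=> us ut; apply: (cvg_unique _ us ut). Qed.

Lemma cvg_succ (u : nat -> C) (s : C) :
  u n @[n --> \oo] --> s -> u n.+1 @[n --> \oo] --> s.
Proof. by rewrite -(cvg_shiftS u). Qed.

Lemma cvg_pred (u : nat -> C) (s : C) :
  u n.+1 @[n --> \oo] --> s -> u n @[n --> \oo] --> s.
Proof. by rewrite (cvg_shiftS u). Qed.

(** Completeness of the complex numbers, inherited from the reals through real
    and imaginary parts, in the only form needed below. *)
Lemma abs_series_cvg (a : nat -> C) (B : R) :
  (forall n, \sum_(l < n) rnorm (a l) <= B) -> exists s : C, \sum_(l < n) a l @[n --> \oo] --> s.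
Proof.
move=> aB.
have real_cvg (b : nat -> R) : (forall n, `|b n| <= rnorm (a n)) ->
    exists t : R, series b @ \oo --> t.
  move=> ba; suff /cvg_ex : cvgn (series b) by [].
  apply: normed_cvg; apply: nondecreasing_is_cvgn.
    by apply: nondecreasing_series => m _ _; apply: normr_ge0.
  exists B => _ [n _ <-]; rewrite /normed_series_of seriesEord /=.
  by apply: (le_trans _ (aB n)); apply: ler_sum.
have [n|s hs] := real_cvg (fun n => complex.Re (a n)).
  by rewrite rnormCE -sqrtr_sqr ler_sqrt ?lerDl ?addr_ge0 ?sqr_ge0.
have [n|t ht] := real_cvg (fun n => complex.Im (a n)).
  by rewrite rnormCE -sqrtr_sqr ler_sqrt ?lerDr ?addr_ge0 ?sqr_ge0.
exists (Complex s t : C); apply/cvg_rnormP => e e0.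
have e2 : 0 < e / 2 by lra.
move/cvgrPdist_lt: hs => /(_ _ e2) hs; move/cvgrPdist_lt: ht => /(_ _ e2) ht.
near=> n.
have -> : \sum_(l < n) a l - Complex s t =
    Complex (series (fun n => complex.Re (a n)) n - s)
            (series (fun n => complex.Im (a n)) n - t).
  have -> : \sum_(l < n) a l = Complex (series (fun n => complex.Re (a n)) n)
     (series (fun n => complex.Im (a n)) n).
    elim: (n) => [|k IH]; first by rewrite !seriesEord /= !big_ord0.
    rewrite big_ord_recr !seriesSr IH. by case: (a k) => x y.
  by [].
set x := _ - s; set y := _ - t.
have hx : `|x| < e / 2 by rewrite /x distrC; near: n; exact: hs.
have hy : `|y| < e / 2 by rewrite /y distrC; near: n; exact: ht.
apply: (@le_lt_trans _ _ (`|x| + `|y|)); last lra.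
rewrite rnormCE /= -(@ler_pXn2r _ 2) ?nnegrE ?sqrtr_ge0 ?addr_ge0 //.
rewrite sqr_sqrtr ?addr_ge0 ?sqr_ge0 // [leRHS]sqrrD !real_normK ?num_real //.
have := mulr_ge0 (normr_ge0 x) (normr_ge0 y); lra.
Unshelve. all: by end_near. Qed.

End RealNorm.

(** * Power series on discs and their division by linear factors *)

Section PowerSeries.
Variable R : realType.
Local Notation C := (cplx R).
Implicit Types (a b : nat -> C) (g h : C -> C) (mu lam nu u z : C) (r B : R).

(** Partial sums of the weighted norm of a coefficient sequence. This norm is
    used instead of a supremum over the disc because its behaviour under
    division and differentiation follows from the coefficients alone, without
    contour integrals. *)
Definition weighted a r n : R := \sum_(l < n) rnorm (a l) * r ^+ l.

(** The radius and the bound are parameters because the proof lets the radius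
    shrink to [0] and needs the exact power of [r] in each bound. *)
Definition expands mu r B g := exists a,
  (forall n, weighted a r n <= B) /\
  forall z, rnorm (z - mu) < r ->
    \sum_(l < n) a l * (z - mu) ^+ l @[n --> \oo] --> g z.

Lemma weightedS a r n : weighted a r n.+1 = weighted a r n + rnorm (a n) * r ^+ n.
Proof. by rewrite /weighted big_ord_recr. Qed.

Lemma weighted_le a r n m : 0 <= r -> (n <= m)%N -> weighted a r n <= weighted a r m.
Proof.
move=> r0 /subnK <-; elim: (m - n)%N => [|k IH]; first by rewrite add0n.
by rewrite addSn weightedS (le_trans IH) // lerDl mulr_ge0 ?rnorm_ge0 ?exprn_ge0.
Qed.

Lemma weighted_mono a r r' n : 0 <= r' <= r -> weighted a r' n <= weighted a r n.
Proof.
move=> /andP[r0 rr]; apply: ler_sum => l _; apply: ler_wpM2l; first exact: rnorm_ge0.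
by apply: lerXn2r; rewrite ?nnegrE // (le_trans r0).
Qed.

Lemma weighted_bound0 a r B : (forall n, weighted a r n <= B) -> 0 <= B.
Proof. by move=> /(_ 0%N); rewrite /weighted big_ord0. Qed.

Lemma weighted_term a r B n : 0 <= r -> (forall n, weighted a r n <= B) ->
  rnorm (a n) * r ^+ n <= B.
Proof.
move=> r0 aB; apply: (le_trans _ (aB n.+1)); rewrite weightedS lerDr.
by apply: sumr_ge0 => l _; rewrite mulr_ge0 ?rnorm_ge0 ?exprn_ge0.
Qed.

Lemma rnorm_psum a u r n : rnorm u <= r ->
  rnorm (\sum_(l < n) a l * u ^+ l) <= weighted a r n.
Proof.
move=> ur; apply: (le_trans (rnorm_sum _ _ _)); apply: ler_sum => l _.
rewrite rnormM rnormX; apply: ler_wpM2l; first exact: rnorm_ge0.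
by apply: lerXn2r; rewrite ?nnegrE ?rnorm_ge0 // (le_trans (rnorm_ge0 _) ur).
Qed.

Lemma psum_cvg a u r B : rnorm u <= r -> (forall n, weighted a r n <= B) ->
  exists s : C, \sum_(l < n) a l * u ^+ l @[n --> \oo] --> s.
Proof.
move=> ur aB; apply: (@abs_series_cvg _ (fun l => a l * u ^+ l) B) => n; apply: (le_trans _ (aB n)).
apply: ler_sum => l _; rewrite rnormM rnormX; apply: ler_wpM2l; first exact: rnorm_ge0.
by apply: lerXn2r; rewrite ?nnegrE ?rnorm_ge0 // (le_trans (rnorm_ge0 _) ur).
Qed.

Lemma expands_bound0 mu r B g : expands mu r B g -> 0 <= B.
Proof. by case=> a [/weighted_bound0]. Qed.

Lemma expands_value mu r B g z : expands mu r B g -> rnorm (z - mu) < r -> rnorm (g z) <= B.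
Proof.
move=> [a [aB ag]] zr; apply: (cvg_rnorm_le (ag z zr)); near=> n.
by apply: (le_trans (rnorm_psum _ _ (ltW zr))); apply: aB.
Unshelve. all: by end_near. Qed.

Lemma expands_radius mu r r' B g : 0 <= r' <= r -> expands mu r B g -> expands mu r' B g.
Proof.
move=> rr [a [aB ag]]; exists a; split=> [n|z zr]; first exact: (le_trans (weighted_mono _ _ rr)).
by apply: ag; rewrite (lt_le_trans zr) //; case/andP: rr.
Qed.

Lemma expands_le mu r B B' g : B <= B' -> expands mu r B g -> expands mu r B' g.
Proof. by move=> BB [a [aB ag]]; exists a; split=> // n; apply: (le_trans (aB n)). Qed.

Lemma expands_ext mu r B g h : (forall z, rnorm (z - mu) < r -> g z = h z) ->
  expands mu r B g -> expands mu r B h.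
Proof.
move=> gh [a [aB ag]]; exists a; split; first exact: aB.
move=> z zr; rewrite -(gh z zr); exact: ag.
Qed.

Lemma term_cvg0 a u r B : rnorm u < r -> (forall n, weighted a r n <= B) ->
  a n * u ^+ n @[n --> \oo] --> (0 : C).
Proof.
move=> ur aB; have r0 : 0 < r := le_lt_trans (rnorm_ge0 _) ur.
have B0 := weighted_bound0 aB.
have q1 : `|rnorm u / r| < 1.
  by rewrite ger0_norm ?divr_ge0 ?rnorm_ge0 1?ltW // ltr_pdivrMr // mul1r.
apply/cvg_rnormP => e e0.
have Be : 0 < e / (B + 1) by rewrite divr_gt0 // ltr_pwDr.
move/cvgrPdist_lt: (cvg_expr q1) => /(_ _ Be); apply: filterS => n.
rewrite sub0r normrN normrX ger0_norm ?divr_ge0 ?rnorm_ge0 1?ltW //.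
rewrite ltr_pdivlMr ?ltr_pwDr // subr0 rnormM rnormX => /(le_lt_trans _); apply.
have -> : rnorm (a n) * rnorm u ^+ n = (rnorm u / r) ^+ n * (rnorm (a n) * r ^+ n).
  by rewrite expr_div_n; field; rewrite expf_neq0 // gt_eqF.
apply: ler_wpM2l; first by rewrite exprn_ge0 // divr_ge0 ?rnorm_ge0 // ltW.
by apply: (le_trans (weighted_term _ (ltW r0) aB)); lra.
Qed.

Lemma expands_subc mu r B g (c : C) : 0 <= r ->
  expands mu r B g -> expands mu r (B + rnorm c) (fun z => g z - c).
Proof.
move=> r0 [a [aB ag]]; exists (fun l => if l is 0 then a 0%N - c else a l); split.
  case=> [|n]; first by rewrite /weighted big_ord0 addr_ge0 ?rnorm_ge0 // (weighted_bound0 aB).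
  rewrite /weighted big_ord_recl /= expr0 mulr1.
  have := aB n.+1; rewrite /weighted big_ord_recl /= expr0 mulr1.
  have := rnormB (a 0%N) c; lra.
move=> z zr; have ag' := cvg_succ (ag z zr); apply: cvg_pred.
apply: cvg_eqn (cvgB ag' (cvg_cst c)) => n.
by rewrite /= [LHS]/GRing.add /= !big_ord_recl /= !expr0 !mulr1 addrAC.
Qed.

Lemma expands_mul mu r B g lam : 0 <= r ->
  expands mu r B g -> expands mu r ((rnorm (mu - lam) + r) * B) (fun z => (z - lam) * g z).
Proof.
move=> r0 [a [aB ag]].
pose b l := (if l is k.+1 then a k else 0) + (mu - lam) * a l.
have recl (F : nat -> C) n : \sum_(l < n.+1) F l = F 0%N + \sum_(l < n) F l.+1.
  exact: big_ord_recl.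
exists b; split=> [[|n]|z zr].
- by rewrite /weighted big_ord0 mulr_ge0 ?addr_ge0 ?rnorm_ge0 ?(weighted_bound0 aB).
- apply: (@le_trans _ _ (r * weighted a r n + rnorm (mu - lam) * weighted a r n.+1)).
    rewrite /weighted !big_ord_recl /= !expr0 !mulr1 /b add0r rnormM mulrDr addrCA.
    rewrite lerD2l !mulr_sumr -big_split /=; apply: ler_sum => l _.
    rewrite /bump /= add1n exprS.
    have rl : 0 <= r * r ^+ l by rewrite mulr_ge0 // exprn_ge0.
    have := ler_wpM2r rl (rnormD (a l) ((mu - lam) * a l.+1)); rewrite rnormM; lra.
  rewrite mulrDl addrC lerD //; apply: ler_wpM2l => //; exact: rnorm_ge0.
have cv := ag z zr; have cvS := cvg_succ cv; apply: cvg_pred.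
have -> : (z - lam) * g z = (z - mu) * g z + (mu - lam) * g z by ring.
apply: cvg_eqn (cvgD (cvgMl_tmp (a := z - mu) cv) (cvgMl_tmp (a := mu - lam) cvS)) => n.
rewrite /= [in RHS]big_ord_recl big_ord_recl /= /b !expr0 !mulr1 add0r mulrDr addrCA.
congr (_ + _); rewrite !mulr_sumr -big_split; apply: eq_bigr => l _ /=.
by rewrite /bump /= add1n exprS; ring.
Qed.

(** The coefficients of the quotient of a power series in [u] by [u - nu], when
    the remainder vanishes. *)
Definition quotient_coefs a nu b :=
  nu * b 0%N = - a 0%N /\ forall k, nu * b k.+1 = b k - a k.+1.

(** The recursion makes the product telescope, leaving one boundary term. *)
Lemma quotient_coefs_sum a nu b u n : quotient_coefs a nu b ->
  (u - nu) * (\sum_(k < n.+1) b k * u ^+ k) =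
  b n * u ^+ n.+1 + \sum_(k < n.+1) a k * u ^+ k.
Proof.
move=> [b0 bS]; elim: n => [|n IH].
  rewrite !big_ord_recl !big_ord0 /= !addr0 !expr0 !mulr1 mulrBl b0 opprK expr1.
  by rewrite mulrC.
rewrite big_ord_recr /= mulrDr IH [in RHS]big_ord_recr /=.
have -> : (u - nu) * (b n.+1 * u ^+ n.+1) =
   u ^+ n.+1 * (u * b n.+1 - nu * b n.+1) by ring.
by rewrite bS !exprS; ring.
Qed.

(** Away from the disc the recursion can be solved upwards, since each step
    divides by the large number [nu]. *)
Lemma quotient_outside a nu r B : 0 < r -> 2 * r <= rnorm nu ->
  (forall n, weighted a r n <= B) ->
  exists b, quotient_coefs a nu b /\ forall n, weighted b r n <= B / r.
Proof.
move=> r0 nur aB.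
have nu0 : nu != 0 by rewrite -rnorm_gt0; lra.
pose b := fix b k := if k is k'.+1 then (b k' - a k) / nu else - a 0%N / nu.
exists b; split; first by split=> [|k] /=; field.
have step n : rnorm nu * weighted b r n.+1 <= weighted a r n.+1 + r * weighted b r n.
  elim: n => [|n IH].
    rewrite !weightedS /weighted !big_ord0 mulr0 !add0r !expr0 !mulr1 addr0.
    by rewrite -rnormM mulrC /= divfK // rnormN.
  have ew : r * weighted b r n.+1 = r * weighted b r n + rnorm (b n) * (r * r ^+ n).
    by rewrite weightedS; ring.
  rewrite (weightedS b r n.+1) mulrDr (weightedS a r n.+1).
  have : rnorm nu * (rnorm (b n.+1) * r ^+ n.+1) <=
         (rnorm (b n) + rnorm (a n.+1)) * r ^+ n.+1.
    rewrite mulrA -rnormM; apply: ler_wpM2r; first by rewrite exprn_ge0 // ltW.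
    by rewrite /= mulrC divfK // rnormB.
  rewrite !exprS; lra.
move=> n; apply: (le_trans (weighted_le _ (ltW r0) (leqnSn n))).
rewrite ler_pdivlMr //.
have := step n; have := aB n.+1; have := weighted_le b (ltW r0) (leqnSn n).
have : 0 <= weighted b r n.+1.
  by apply: sumr_ge0 => l _; rewrite mulr_ge0 ?rnorm_ge0 ?exprn_ge0 // ltW.
nra.
Qed.

(** Inside the disc the recursion has to be solved downwards, from infinity: the
    [k]-th coefficient is the tail of the series after [k], which is where the
    vanishing at [nu] and completeness are used. *)
Lemma quotient_inside a nu r B : 0 < r -> rnorm nu <= r / 2 ->
  (forall n, weighted a r n <= B) ->
  \sum_(l < n) a l * nu ^+ l @[n --> \oo] --> (0 : C) ->
  exists b, quotient_coefs a nu b /\ forall n, weighted b r n <= 3 * B / r.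
Proof.
move=> r0 nur aB a_nu.
have tail k n : \sum_(l < n) rnorm (a (k + l)%N) * r ^+ (k + l) <= B.
  apply: (le_trans _ (aB (k + n)%N)); rewrite /weighted big_split_ord /= lerDr.
  by apply: sumr_ge0 => l _; rewrite mulr_ge0 ?rnorm_ge0 ?exprn_ge0 // ltW.
have tail' k n : weighted (fun l => a (k + l)%N) r n <= B / r ^+ k.
  rewrite ler_pdivlMr ?exprn_gt0 //; apply: (le_trans _ (tail k n)).
  rewrite /weighted mulr_suml; apply: ler_sum => l _.
  by rewrite exprD [r ^+ k * _]mulrC mulrA.
have nur' : rnorm nu <= r by lra.
have cv k : exists s : C, \sum_(l < n) a (k + l)%N * nu ^+ l @[n --> \oo] --> s.
  exact: (psum_cvg nur' (tail' k)).
have [s s_lim] := choice cv.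
have sS k : s k = a k + nu * s k.+1.
  apply: (cvg_lim_eq (s_lim k)).
  apply: cvg_pred; apply: cvg_eqn (cvgD (cvg_cst (a k)) (cvgMl_tmp (a := nu) (s_lim k.+1))) => n.
  rewrite /= big_ord_recl /= addn0 expr0 mulr1 mulr_sumr; congr (_ + _).
  by apply: eq_bigr => l _; rewrite /bump /= add1n addnS exprS; ring.
have s0 : s 0%N = 0 := cvg_lim_eq (s_lim 0%N) a_nu.
exists (fun k => s k.+1); split.
  split=> [|k].
    have := sS 0%N; rewrite s0 => /eqP; rewrite eq_sym addr_eq0 => /eqP ->.
    by rewrite opprK.
  by rewrite (sS k.+1) addrAC subrr add0r.
have sB k : rnorm (s k) * r ^+ k <= B.
  rewrite -ler_pdivlMr ?exprn_gt0 //.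
  apply: (cvg_rnorm_le (s_lim k)); near=> n.
  by apply: (le_trans (rnorm_psum (fun l => a (k + l)%N) n nur')); apply: tail'.
set b := fun k => s k.+1.
have step n : r * weighted b r n <= weighted a r n.+1 + rnorm nu * weighted b r n.+1.
  elim: n => [|n IH].
    rewrite !weightedS /weighted !big_ord0 mulr0 !add0r !expr0 !mulr1.
    by rewrite addr_ge0 ?mulr_ge0 ?rnorm_ge0.
  have ew : r * weighted b r n.+1 = r * weighted b r n + rnorm (b n) * (r * r ^+ n).
    by rewrite weightedS; ring.
  rewrite ew (weightedS a r n.+1) (weightedS b r n.+1) mulrDr.
  have rn : 0 <= r * r ^+ n by rewrite -exprS exprn_ge0 // ltW.
  have := ler_wpM2r rn (rnormD (a n.+1) (nu * b n.+1)).
  by rewrite -[a _ + _]sS rnormM !exprS -/(b n); lra.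
move=> n; rewrite ler_pdivlMr //.
have bn : rnorm nu * (rnorm (b n) * r ^+ n) <= B / 2.
  apply: (@le_trans _ _ (r / 2 * (rnorm (b n) * r ^+ n))).
    by apply: ler_wpM2r => //; rewrite mulr_ge0 ?rnorm_ge0 ?exprn_ge0 // ltW.
  have := sB n.+1; rewrite -/(b n) exprS; lra.
have w0 : 0 <= weighted b r n.
  by apply: sumr_ge0 => l _; rewrite mulr_ge0 ?rnorm_ge0 ?exprn_ge0 // ltW.
have := step n; rewrite (weightedS b) mulrDr; have := aB n.+1.
have := ler_wpM2r w0 nur; lra.
Unshelve. all: by end_near. Qed.

(** At [z = lam] itself the identity of [quotient_coefs_sum] says nothing, so the
    value of the quotient there is a separate hypothesis. *)
Lemma expands_quotient a b mu lam r B h : quotient_coefs a (lam - mu) b ->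
  (forall n, weighted b r n <= B) ->
  (forall z, rnorm (z - mu) < r ->
     \sum_(l < n) a l * (z - mu) ^+ l @[n --> \oo] --> (z - lam) * h z) ->
  (rnorm (lam - mu) < r ->
     \sum_(l < n) b l * (lam - mu) ^+ l @[n --> \oo] --> h lam) ->
  expands mu r B h.
Proof.
move=> ab bB a_lim b_lim; exists b; split; first exact: bB.
move=> z zr.
have [zlam|z_lam] := eqVneq z lam; first by rewrite zlam; apply: b_lim; rewrite -zlam.
have zl0 : z - lam != 0 by rewrite subr_eq0.
have c1 : b n * (z - mu) ^+ n.+1 @[n --> \oo] --> (0 : C).
  rewrite -[0](mulr0 (z - mu)).
  apply: cvg_eqn (cvgMl_tmp (a := z - mu) (term_cvg0 zr bB)) => n.
  by rewrite exprS; ring.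
have c2 : b n * (z - mu) ^+ n.+1 + \sum_(l < n.+1) a l * (z - mu) ^+ l @[n --> \oo]
    --> 0 + (z - lam) * h z by apply: cvgD c1 (cvg_succ (a_lim z zr)).
apply: cvg_pred; rewrite -[h z](mulKf zl0) -[(z - lam) * h z]add0r.
apply: cvg_eqn (cvgMl_tmp (a := (z - lam)^-1) c2) => n.
have -> : z - lam = (z - mu) - (lam - mu) by ring.
rewrite -(quotient_coefs_sum _ _ ab) mulKf //.
by have -> : (z - mu) - (lam - mu) = z - lam by ring.
Qed.

(** The remainder theorem on a union of discs of radius [r]: subtracting the
    value at [lam] and dividing by [z - lam] costs a factor [6 / r] in the
    weighted norms, provided [lam] is well inside one disc and well outside the
    others. The quotient at [lam] is the sum of the quotient series of the disc
    that contains [lam]. *)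
Lemma divide (S : seq C) mu0 r B g lam : 0 < r -> mu0 \in S ->
  (forall mu, mu \in S -> expands mu r B g) ->
  rnorm (lam - mu0) <= r / 2 ->
  (forall mu, mu \in S -> mu != mu0 -> 2 * r <= rnorm (lam - mu)) ->
  exists h, [/\ forall z, g z = g lam + (z - lam) * h z, rnorm (g lam) <= B &
    forall mu, mu \in S -> expands mu r (6 * B / r) h].
Proof.
move=> r0 mu0S gS lam_in lam_out.
have lam_r : rnorm (lam - mu0) < r by lra.
have glB : rnorm (g lam) <= B by apply: expands_value (gS _ mu0S) lam_r.
have g'S mu : mu \in S -> expands mu r (2 * B) (fun z => g z - g lam).
  move=> /gS /(expands_subc (g lam) (ltW r0)); apply: expands_le; lra.
have B0 : 0 <= B := expands_bound0 (gS _ mu0S).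
have [a [aB a_lim]] := g'S _ mu0S.
have [|b [ab bB]] := quotient_inside r0 lam_in aB.
  have := a_lim lam lam_r; rewrite subrr; exact.
have [d b_lim] := psum_cvg (ltW lam_r) bB.
pose h z := if z == lam then d else (g z - g lam) / (z - lam).
have hE z : (z - lam) * h z = g z - g lam.
  rewrite /h; have [->|zl] := eqVneq; first by rewrite !subrr mul0r.
  by rewrite mulrC divfK // subr_eq0.
exists h; split; [by move=> z; rewrite hE addrC subrK | exact: glB |].
move=> mu muS; have [->|mu_mu0] := eqVneq mu mu0.
  apply: (@expands_quotient a b _ lam _ _ _ ab) => [n|z zr|_].
  - by have -> : 6 * B / r = 3 * (2 * B) / r by ring.
  - rewrite hE; exact: (a_lim z zr).
  - rewrite /h eqxx; exact: b_lim.
have [a' [a'B a'_lim]] := g'S _ muS.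
have lam_mu := lam_out _ muS mu_mu0.
have [b' [ab' b'B]] := quotient_outside r0 lam_mu a'B.
apply: (@expands_quotient a' b' _ lam _ _ _ ab') => [n|z zr|].
- apply: (le_trans (b'B n)); rewrite ler_pM2r ?invr_gt0 //; lra.
- rewrite hE; exact: (a'_lim z zr).
- by lra.
Qed.

End PowerSeries.

(** * Differentiation of power series *)

Section Derivatives.
Variable R : realType.
Local Notation C := (cplx R).
Implicit Types (a b : nat -> C) (f g h : C -> C) (mu lam nu u z : C) (r B : R).

Lemma is_derive_quadratic g z D (K del : R) : 0 < del ->
  (forall w, rnorm (w - z) < del -> rnorm (g w - g z - (w - z) * D) <= K * rnorm (w - z) ^+ 2) ->
  is_derive z 1 g D.
Proof.
move=> del0 gK.
have cv : h^-1 *: ((g \o shift z) (h *: (1 : C)) - g z) @[h --> 0^'] --> D.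
  apply/cvg_rnormP => e e0.
  have K1 : 0 < `|K| + 1 by have := normr_ge0 K; lra.
  have d0 : 0 < Num.min del (e / (`|K| + 1)) by rewrite lt_min del0 divr_gt0.
  near=> h.
  have h0 : h != 0 by near: h; exact: nbhs_dnbhs_neq.
  have : rnorm h < Num.min del (e / (`|K| + 1)).
    near: h; apply: nbhs_dnbhs; apply/nbhs_rnormP; exists (Num.min del (e / (`|K| + 1))) => //.
    by move=> y; rewrite subr0.
  rewrite lt_min ltr_pdivlMr // => /andP[hdel he].
  have := gK (h + z); rewrite addrK => /(_ hdel) gh.
  have hp : 0 < rnorm h by rewrite rnorm_gt0.
  rewrite /= -(ltr_pM2l hp) -rnormM.
  have -> : h * (h^-1 *: (g (h *: (1 : C) + z) - g z) - D) = g (h + z) - g z - h * D.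
    by rewrite /GRing.scale /= mulr1; field.
  apply: (le_lt_trans gh); rewrite expr2 mulrCA ltr_pM2l //.
  apply: le_lt_trans he; rewrite mulrC; apply: ler_wpM2l; first exact: rnorm_ge0.
  by have := ler_norm K; lra.
split; first by apply/cvg_ex; exists D.
by apply/cvg_lim.
Unshelve. all: by end_near. Qed.

(** By the binomial theorem the Taylor remainder of [x ^+ l] at [v] is dominated
    by the terms of degree at least [2] in [eta] of [(rho + eta) ^+ l], scaled by
    [(rnorm d / eta) ^+ 2]. One estimate thus serves all powers, and a series
    can be differentiated term by term without a uniform convergence
    argument. *)
Lemma pow_remainder (v d : C) (rho eta : R) l : rnorm v <= rho -> 0 < eta -> rnorm d <= eta ->
  rnorm ((v + d) ^+ l - v ^+ l - l%:R * v ^+ l.-1 * d) <=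
  (rnorm d / eta) ^+ 2 * (rho + eta) ^+ l.
Proof.
move=> vr eta0 deta.
have rho0 : 0 <= rho := le_trans (rnorm_ge0 _) vr.
have d0 := rnorm_ge0 d.
set e := rnorm d / eta.
have e0 : 0 <= e by rewrite divr_ge0 // ltW.
have de : rnorm d = e * eta by rewrite /e divfK // gt_eqF.
have mono : rho ^+ l + l%:R * rho ^+ l.-1 * eta >= 0.
  by rewrite addr_ge0 ?mulr_ge0 ?exprn_ge0 // ltW.
(* subtracting the two lowest terms turns the induction step into an equality *)
suff : rnorm ((v + d) ^+ l - v ^+ l - l%:R * v ^+ l.-1 * d) <=
    e ^+ 2 * ((rho + eta) ^+ l - rho ^+ l - l%:R * rho ^+ l.-1 * eta).
  move/le_trans; apply; apply: ler_wpM2l; first exact: sqr_ge0.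
  by move: mono; lra.
clear mono; elim: l => [|l IH].
  by rewrite !expr0 !mul0r !subr0 !subrr mulr0 rnorm0.
have -> : (v + d) ^+ l.+1 - v ^+ l.+1 - l.+1%:R * v ^+ l.+1.-1 * d =
   (v + d) * ((v + d) ^+ l - v ^+ l - l%:R * v ^+ l.-1 * d) + l%:R * v ^+ l.-1 * d ^+ 2.
  case: l {IH} => [|l]; first by rewrite /= !expr0 !expr1; ring.
  by rewrite /= !exprS -natr1; ring.
have -> : (rho + eta) ^+ l.+1 - rho ^+ l.+1 - l.+1%:R * rho ^+ l.+1.-1 * eta =
   (rho + eta) * ((rho + eta) ^+ l - rho ^+ l - l%:R * rho ^+ l.-1 * eta) +
   l%:R * rho ^+ l.-1 * eta ^+ 2.
  case: l {IH} => [|l]; first by rewrite /= !expr0 !expr1; ring.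
  by rewrite /= !exprS -natr1; ring.
apply: (le_trans (rnormD _ _)); rewrite [leRHS]mulrDr; apply: lerD.
  rewrite rnormM mulrCA; apply: ler_pM; rewrite ?rnorm_ge0 //.
  by apply: (le_trans (rnormD _ _)); rewrite lerD.
rewrite !rnormM !rnormX rnorm_nat de.
have -> : e ^+ 2 * (l%:R * rho ^+ l.-1 * eta ^+ 2) = l%:R * rho ^+ l.-1 * (e * eta) ^+ 2 by ring.
apply: ler_wpM2r; first exact: sqr_ge0.
apply: ler_wpM2l => //; apply: lerXn2r => //; rewrite nnegrE ?rnorm_ge0 //.
Qed.

(** One term of the binomial expansion of the right-hand side. *)
Lemma deriv_weight (rho eta : R) l : 0 <= rho -> 0 < eta ->
  l.+1%:R * rho ^+ l <= (rho + eta) ^+ l.+1 / eta.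
Proof.
move=> rho0 eta0; rewrite ler_pdivlMr //.
suff : l.+1%:R * rho ^+ l * eta + rho ^+ l.+1 <= (rho + eta) ^+ l.+1.
  by have := exprn_ge0 l.+1 rho0; lra.
elim: l => [|l IH]; first by rewrite !expr1; lra.
rewrite [leRHS]exprS.
have := ler_wpM2l (addr_ge0 rho0 (ltW eta0)) IH; apply: le_trans.
have p0 := exprn_ge0 l rho0; have n0 : 0 <= l.+1%:R :> R by [].
have q0 : 0 <= l.+1%:R * rho ^+ l * eta ^+ 2 := mulr_ge0 (mulr_ge0 n0 p0) (sqr_ge0 eta).
have -> : l.+2%:R = l.+1%:R + 1 :> R by rewrite natr1.
by move: q0; rewrite !exprS expr0 mulr1; lra.
Qed.

(** Differentiation costs a loss of radius [eta] and a factor [1 / eta], as in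
    Cauchy's estimate. *)
Lemma expands_derive mu (rho eta B : R) g : 0 <= rho -> 0 < eta ->
  expands mu (rho + eta) B g ->
  expands mu rho (B / eta) (derive1 g) /\
  forall z, rnorm (z - mu) < rho -> derivable g z 1.
Proof.
move=> rho0 eta0 [a [aB ag]].
pose a' l := l.+1%:R * a l.+1.
have a'B n : weighted a' rho n <= B / eta.
  apply: (@le_trans _ _ (weighted a (rho + eta) n.+1 / eta)); last first.
    by rewrite ler_pM2r ?invr_gt0.
  rewrite /weighted big_ord_recl mulrDl -[leLHS]add0r; apply: lerD.
    by rewrite divr_ge0 ?mulr_ge0 ?rnorm_ge0 ?exprn_ge0 ?addr_ge0 // ltW.
  rewrite mulr_suml; apply: ler_sum => l _; rewrite /= /bump /= add1n.
  rewrite rnormM rnorm_nat [_ * rnorm _]mulrC -!mulrA; apply: ler_wpM2l; first exact: rnorm_ge0.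
  exact: deriv_weight.
have cv (z : C) : exists s : C, rnorm (z - mu) <= rho ->
    \sum_(l < n) a' l * (z - mu) ^+ l @[n --> \oo] --> s.
  have [zr|_] := boolP (rnorm (z - mu) <= rho); last by exists 0.
  by have [s hs] := psum_cvg zr a'B; exists s.
have [g' g'P] := choice cv.
have dg z : rnorm (z - mu) < rho -> is_derive z 1 g (g' z).
  move=> zr; apply: (@is_derive_quadratic _ _ _ (B / eta ^+ 2) eta) => // w wz.
  have wr : rnorm (w - mu) < rho + eta.
    have -> : w - mu = (z - mu) + (w - z) by ring.
    by apply: (le_lt_trans (rnormD _ _)); lra.
  have zr' : rnorm (z - mu) < rho + eta by lra.
  have c1 : \sum_(l < n.+1) a l * (w - mu) ^+ l - \sum_(l < n.+1) a l * (z - mu) ^+ l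
      @[n --> \oo] --> g w - g z.
    by apply: cvgB (cvg_succ (ag w wr)) (cvg_succ (ag z zr')).
  have c2 : \sum_(l < n.+1) a l * (w - mu) ^+ l - \sum_(l < n.+1) a l * (z - mu) ^+ l -
      (w - z) * (\sum_(l < n) a' l * (z - mu) ^+ l)
      @[n --> \oo] --> g w - g z - (w - z) * g' z.
    by apply: cvgB c1 (cvgMl_tmp (g'P z (ltW zr))).
  apply: (cvg_rnorm_le c2); near=> n.
  rewrite (_ : (w - z) * _ =
     \sum_(l < n.+1) a l * (l%:R * (z - mu) ^+ l.-1 * (w - z))); last first.
    rewrite [RHS]big_ord_recl /= mul0r mul0r mulr0 add0r mulr_sumr; apply: eq_bigr => l _.
    by rewrite /a' /bump /= add1n; ring.
  rewrite -!sumrB (eq_bigr (fun l : 'I_n.+1 => a l *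
     ((w - mu) ^+ l - (z - mu) ^+ l - l%:R * (z - mu) ^+ l.-1 * (w - z)))); last first.
    by move=> l _; ring.
  apply: (@le_trans _ _ ((rnorm (w - z) / eta) ^+ 2 * weighted a (rho + eta) n.+1)).
    apply: (le_trans (rnorm_sum _ _ _)); rewrite mulr_sumr; apply: ler_sum => l _.
    rewrite rnormM mulrCA; apply: ler_wpM2l; first exact: rnorm_ge0.
    have -> : w - mu = (z - mu) + (w - z) by ring.
    by apply: pow_remainder => //; apply: ltW.
  have -> : B / eta ^+ 2 * rnorm (w - z) ^+ 2 = (rnorm (w - z) / eta) ^+ 2 * B.
    by field; rewrite gt_eqF.
  by apply: ler_wpM2l; rewrite ?sqr_ge0.
split; last by move=> z /dg[].
exists a'; split=> // z zr; rewrite derive1E.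
by have [_ ->] := dg z zr; apply: g'P; apply: ltW.
Unshelve. all: by end_near. Qed.

End Derivatives.

(** * Higher derivatives at multiple roots *)

Section Smooth.
Variable R : realType.
Local Notation C := (cplx R).
Implicit Types (f g h : C -> C) (mu lam nu u z : C) (r B : R) (U : set C) (s : seq C).

Definition smooth_on U f := forall n z, U z -> derivable (derive1n n f) z 1.

(** Each differentiation may shrink the disc by as little as desired, so that no
    point of the open disc is ever lost. *)
Lemma expands_smooth mu r B g : expands mu r B g ->
  smooth_on [set z | rnorm (z - mu) < r] g.
Proof.
move=> gE n; elim: n r B g gE => [|n IH] r B g gE z zr; rewrite /mkset in zr.
all: pose rho := (rnorm (z - mu) + r) / 2.
all: have rho0 : 0 <= rho by have := rnorm_ge0 (z - mu); rewrite /rho; lra.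
all: have eta0 : 0 < r - rho by rewrite /rho; lra.
all: have zrho : rnorm (z - mu) < rho by rewrite /rho; lra.
all: have rE : r = rho + (r - rho) by rewrite addrC subrK.
all: rewrite {}rE in gE; have [g'E dg] := expands_derive rho0 eta0 gE.
  exact: dg.
by rewrite derive1Sn; apply: (IH _ _ _ g'E).
Qed.

Lemma open_near U f g z : open U -> U z -> (forall z, U z -> f z = g z) -> {near z, f =1 g}.
Proof. by move=> oU Uz fg; apply: filterS (open_nbhs_nbhs (conj oU Uz)) => w; apply: fg. Qed.

Lemma derive1n_local U f g : open U -> (forall z, U z -> f z = g z) ->
  forall n z, U z -> derive1n n f z = derive1n n g z.
Proof.
move=> oU fg; elim=> [|n IH] z Uz; first exact: fg.
by rewrite !derive1nS !derive1E; apply: near_eq_derive; exact: (open_near oU Uz IH).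
Qed.

Lemma smooth_local U f g : open U -> (forall z, U z -> f z = g z) ->
  smooth_on U f -> smooth_on U g.
Proof.
move=> oU fg fU n z Uz; apply: near_eq_derivable (fU n z Uz).
exact: (open_near oU Uz (derive1n_local oU fg n)).
Qed.

Lemma derive1n_add U f g : open U -> smooth_on U f -> smooth_on U g ->
  forall n z, U z -> derive1n n (fun z => f z + g z) z = derive1n n f z + derive1n n g z.
Proof.
move=> oU fU gU; elim=> [|n IH] z Uz //.
rewrite !derive1nS !derive1E.
rewrite (near_eq_derive (g := (derive1n n f : C -> C) + (derive1n n g : C -> C))).
  by rewrite deriveD //; [exact: fU | exact: gU].
exact: (open_near oU Uz IH).
Qed.

Lemma is_derive_subr lam z : is_derive z 1 (fun w : C => w - lam) 1.
Proof.
apply: (@is_derive_quadratic _ _ _ _ 0 1) => // w _.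
by have -> : w - lam - (z - lam) - (w - z) * 1 = 0; [ring | rewrite rnorm0 mul0r].
Qed.

Lemma smooth_is_derive U h n z : smooth_on U h -> U z ->
  is_derive z 1 (derive1n n h) (derive1n n.+1 h z).
Proof. by move=> hU Uz; rewrite derive1nS derive1E; apply: derivableP; exact: hU. Qed.

Lemma is_derive_linear_comb lam (c : C) z f g (df dg : C) :
  is_derive z 1 f df -> is_derive z 1 g dg ->
  is_derive z 1 (fun w => (w - lam) * f w + c * g w) (f z + (z - lam) * df + c * dg).
Proof.
move=> fd gd; have d1 := is_derive_subr lam z.
have -> : (fun w => (w - lam) * f w + c * g w) = ((fun w : C => w - lam) * f + cst c * g).
  by [].
have := is_deriveD (is_deriveM d1 fd) (is_deriveM (is_derive_cst c z 1) gd).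
move=> d; apply: (is_derive_eq d); rewrite /GRing.scale /cst /=; ring.
Qed.

Lemma is_derive_mul_linear U lam h n z : smooth_on U h -> U z ->
  is_derive z 1 (fun w => (w - lam) * derive1n n h w + n%:R * derive1n n.-1 h w)
    ((z - lam) * derive1n n.+1 h z + n.+1%:R * derive1n n h z).
Proof.
move=> hU Uz.
have d := is_derive_linear_comb lam n%:R (smooth_is_derive n hU Uz)
  (smooth_is_derive n.-1 hU Uz).
suff <- : derive1n n h z + (z - lam) * derive1n n.+1 h z + n%:R * derive1n n.-1.+1 h z =
  (z - lam) * derive1n n.+1 h z + n.+1%:R * derive1n n h z by exact: d.
case: n {d} => [|n]; first by rewrite !mul0r addr0 mul1r addrC.
rewrite -[n.+2%:R]natr1 succnK; move: (derive1n n.+1 h z) (derive1n n.+2 h z) => x y.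
by ring.
Qed.

Lemma derive1n_mul_linear U lam h : open U -> smooth_on U h -> forall n z, U z ->
  derive1n n (fun z => (z - lam) * h z) z =
  (z - lam) * derive1n n h z + n%:R * derive1n n.-1 h z.
Proof.
move=> oU hU; elim=> [|n IH] z Uz; first by rewrite mul0r addr0.
rewrite derive1nS derive1E (near_eq_derive _ (open_near oU Uz IH)).
by have [_ ->] := is_derive_mul_linear lam n hU Uz.
Qed.

Lemma smooth_mul_linear U lam h : open U -> smooth_on U h ->
  smooth_on U (fun z => (z - lam) * h z).
Proof.
move=> oU hU n z Uz; have [d _] := is_derive_mul_linear lam n hU Uz.
apply: near_eq_derivable d; apply: (open_near oU Uz) => w Uw.
exact/esym/(derive1n_mul_linear lam oU hU).
Qed.

Lemma smooth_mul_prod U s h : open U -> smooth_on U h ->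
  smooth_on U (fun z => (\prod_(lam <- s) (z - lam)) * h z).
Proof.
move=> oU hU; elim: s => [|lam s IH].
  by apply: (smooth_local oU _ hU) => z _; rewrite big_nil mul1r.
have e z : (z - lam) * (\prod_(lam <- s) (z - lam) * h z) =
    \prod_(lam <- lam :: s) (z - lam) * h z by rewrite big_cons mulrA.
exact: (smooth_local oU (fun z _ => e z) (smooth_mul_linear (lam := lam) oU IH)).
Qed.

(** Each linear factor vanishing at [z] absorbs one derivative, by the Leibniz
    rule for a product with a linear function. *)
Lemma derive1n_prod_root U s h z n : open U -> smooth_on U h -> U z ->
  (n < count_mem z s)%N ->
  derive1n n (fun z => (\prod_(lam <- s) (z - lam)) * h z) z = 0.
Proof.
move=> oU hU Uz; elim: s n => [|lam s IH] n //=.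
move=> n_count.
pose k w := \prod_(lam <- s) (w - lam) * h w.
have e w : \prod_(lam <- lam :: s) (w - lam) * h w = (w - lam) * k w.
  by rewrite big_cons mulrA.
have kU : smooth_on U k := smooth_mul_prod (s := s) oU hU.
rewrite (derive1n_local oU (fun w _ => e w) n Uz) (derive1n_mul_linear lam oU kU n Uz).
move: n_count; have [->|lam_z] := eqVneq lam z.
  case: n => [|n] /=; first by rewrite subrr !mul0r addr0.
  by rewrite add1n ltnS => n_count; rewrite subrr mul0r (IH n) // mulr0 addr0.
rewrite add0n => n_count; rewrite IH // IH ?mulr0 ?addr0 //.
by rewrite (leq_ltn_trans (leq_pred _)).
Qed.

Lemma is_derive_horner (p : {poly C}) z : is_derive z 1 (horner p) p^`().[z].
Proof.
elim/poly_ind: p => [|p c IH].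
  have -> : horner (0 : {poly C}) = cst 0 by apply/funext => w; rewrite horner0.
  by rewrite deriv0 horner0; apply: is_derive_cst.
have -> : horner (p * 'X + c%:P) = horner p * id + cst c.
  by apply/funext => w; rewrite !hornerE.
have d := is_deriveD (is_deriveM IH (is_derive_id z 1)) (is_derive_cst c z 1).
apply: (is_derive_eq d).
by rewrite derivD derivC derivM derivX !hornerE /GRing.scale /=; ring.
Qed.

Lemma derive1n_horner n (p : {poly C}) : derive1n n (horner p) = horner (p^`(n)).
Proof.
elim: n => [|n IH]; first by rewrite derivn0.
rewrite derive1nS IH derivnS; apply/funext => z; rewrite derive1E.
by have [_ ->] := is_derive_horner p^`(n) z.
Qed.

Lemma smooth_horner U (p : {poly C}) : smooth_on U (horner p).
Proof. by move=> n z _; rewrite derive1n_horner; have [] := is_derive_horner p^`(n) z. Qed.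

(** This is how a decomposition of [f] as a polynomial plus a multiple of the
    node polynomial yields the Hermite conditions on derivatives. *)
Lemma derive1n_interpolant U s f h (p : {poly C}) : open U -> smooth_on U h ->
  (forall z, U z -> f z = p.[z] + \prod_(lam <- s) (z - lam) * h z) ->
  forall z n, U z -> (n < count_mem z s)%N -> p^`(n).[z] = derive1n n f z.
Proof.
move=> oU hU fE z n Uz n_count.
have mU := smooth_mul_prod (s := s) oU hU.
rewrite (derive1n_local oU fE n Uz) (derive1n_add oU (@smooth_horner U p) mU n Uz).
by rewrite (derive1n_prod_root oU hU Uz n_count) addr0 derive1n_horner.
Qed.

End Smooth.

(** * Matrix norms and Newton interpolation *)

Section Interpolation.
Variable R : realType.
Local Notation C := (cplx R).
Implicit Types (f g h : C -> C) (mu lam nu u z : C) (r B Q : R) (s S : seq C) (p q : {poly C}).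

Lemma rnorm_mx_entry m n (A : 'M[C]_(m, n)) i j : rnorm (A i j) <= rnorm A.
Proof.
have ij_le (ij : 'I_m * 'I_n) : `|A ij.1 ij.2| <= mx_norm A.
  by rewrite mx_normE -[leLHS]nngE num_le; exact: le_bigmax.
by rewrite rnorm_le -normE; exact: (ij_le (i, j)).
Qed.

Lemma rnorm_mx_le m n (A : 'M[C]_(m, n)) e : 0 <= e ->
  (forall i j, rnorm (A i j) <= e) -> rnorm A <= e.
Proof.
move=> e0 Ae.
have [A0|/eqP] := eqVneq (rnorm A) 0; first by rewrite A0.
move=> A0; have A0' : mx_norm A != 0.
  apply/eqP => h; apply: A0; apply: toC_inj.
  by rewrite -normE; exact: h.
have [[i j] /= ij] := mx_norm_neq0 A0'.
apply: (le_trans _ (Ae i j)); rewrite rnorm_le -normE.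
by rewrite [leLHS]ij.
Qed.

Lemma rnorm_mulmx m n k (A : 'M[C]_(m, n)) (B : 'M[C]_(n, k)) :
  rnorm (A *m B) <= n%:R * rnorm A * rnorm B.
Proof.
apply: rnorm_mx_le => [|i j]; first by rewrite !mulr_ge0 ?rnorm_ge0.
rewrite mxE; apply: (le_trans (rnorm_sum _ _ _)).
apply: (@le_trans _ _ (\sum_(l < n) rnorm A * rnorm B)).
  by apply: ler_sum => l _; rewrite rnormM ler_pM ?rnorm_ge0 ?rnorm_mx_entry.
by rewrite sumr_const card_ord -mulrA mulr_natl.
Qed.

Lemma rnorm_scalar_mx n (c : C) : rnorm (c%:M : 'M[C]_n) <= rnorm c.
Proof.
apply: rnorm_mx_le => [|i j]; first exact: rnorm_ge0.
by rewrite mxE; case: (i == j); rewrite ?mulr1n // mulr0n rnorm0 rnorm_ge0.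
Qed.

Lemma derivn_dvdp p z m : (forall k, (k < m)%N -> p^`(k).[z] = 0) -> ('X - z%:P) ^+ m %| p.
Proof.
elim: m p => [|m IH] p pz; first by rewrite expr0 dvd1p.
have /factor_theorem[q pE] : root p z by apply/rootP; exact: (pz 0%N).
rewrite pE exprS mulrC dvdp_mul2r ?polyXsubC_eq0 //; apply: IH => k km.
have := pz k.+1 km; rewrite pE mulrBr -[q * z%:P]mulrC mul_polyC.
have -> : q * 'X - z *: q = (q * 'X + 0%:P) - z *: q by rewrite addr0.
rewrite derivnB derivnMXaddC derivnZ !hornerE hornerMn [X in _ + X - _]mulrC addrK => /eqP.
by rewrite mulrn_eq0 => /eqP.
Qed.

(** Uniqueness of Hermite interpolation: a polynomial with more roots than its
    degree, counted with multiplicity, vanishes. *)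
Lemma derivn_eq0 p s : (size p <= size s)%N ->
  (forall z k, (k < count_mem z s)%N -> p^`(k).[z] = 0) -> p = 0.
Proof.
move=> ps pz; apply/eqP/negP => /negP p0.
have [r pr] := closed_field_poly_normal p.
have lc0 : lead_coef p != 0 by rewrite lead_coef_eq0.
have /count_subseqP[s' /size_subseq s'r /perm_size ss'] :
    forall z, (count_mem z s <= count_mem z r)%N.
  move=> z; have := derivn_dvdp (pz z); rewrite -mup_geq // pr.
  by rewrite -mul_polyC mupMr ?mu_prod_XsubC // rootC.
move: ps; rewrite pr size_scale // size_prod_XsubC ss' => /leq_trans/(_ s'r).
by rewrite ltnn.
Qed.

(** Newton interpolation at the nodes [s], by repeated division with remainder.
    The nodes may be repeated and may cluster: the bound depends on the nodes
    only through their position relative to the discs. Nested evaluation of the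
    Newton form bounds the values at matrices, with the loss of one factor
    [1 / r] per node. *)
Lemma newton S r s B g : 0 < r ->
  (forall mu nu, mu \in S -> nu \in S -> mu != nu -> 3 * r <= rnorm (mu - nu)) ->
  (forall lam, lam \in s -> exists2 mu, mu \in S & rnorm (lam - mu) <= r / 2) ->
  0 <= B -> (forall mu, mu \in S -> expands mu r B g) ->
  exists p h, [/\ forall z, g z = p.[z] + \prod_(lam <- s) (z - lam) * h z,
    exists B', forall mu, mu \in S -> expands mu r B' h &
    forall n (X : 'M[C]_n.+1) Q, 0 <= Q ->
      (forall lam, lam \in s -> n.+1%:R * (rnorm X + rnorm lam) <= Q) ->
      rnorm (horner_mx X p) <= (1 + 6 * Q / r) ^+ size s * B].
Proof.
move=> r0 Ssep; elim: s B g => [|lam s IH] B g sS B0 gS.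
  exists 0, g; split=> [z||n X Q Q0 _].
  - by rewrite horner0 big_nil mul1r add0r.
  - by exists B.
  - by rewrite rmorph0 rnorm0 expr0 mul1r.
have [|mu0 mu0S lam_mu0] := sS lam; first by rewrite mem_head.
have [mu muS mu_mu0|h [gE glB hS]] := divide r0 mu0S gS lam_mu0.
  have := Ssep _ _ muS mu0S mu_mu0.
  have -> : mu - mu0 = (lam - mu0) - (lam - mu) by ring.
  have := rnormB (lam - mu0) (lam - mu); lra.
have sS' nu : nu \in s -> exists2 mu, mu \in S & rnorm (nu - mu) <= r / 2.
  by move=> nus; apply: sS; rewrite inE nus orbT.
have B1 : 0 <= 6 * B / r by rewrite divr_ge0 ?mulr_ge0 // ltW.
have [p [k [hE kS pX]]] := IH _ _ sS' B1 hS.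
exists ((g lam)%:P + ('X - lam%:P) * p), k; split=> [z||n X Q Q0 Qs].
- by rewrite gE hE !hornerE big_cons; ring.
- exact: kS.
rewrite rmorphD rmorphM rmorphB /= !horner_mx_C horner_mx_X -mulmxE.
have t0 : 0 <= 6 * Q / r by rewrite divr_ge0 ?mulr_ge0 // ltW.
have {}pX : rnorm (horner_mx X p) <= (1 + 6 * Q / r) ^+ size s * (6 * B / r).
  by apply: pX => // nu nus; apply: Qs; rewrite inE nus orbT.
have QX : n.+1%:R * rnorm (X - lam%:M) <= Q.
  apply: le_trans (Qs lam (mem_head _ _)); apply: ler_wpM2l => //.
  by apply: (le_trans (rnormB _ _)); rewrite lerD2l rnorm_scalar_mx.
apply: (@le_trans _ _ (B + Q * ((1 + 6 * Q / r) ^+ size s * (6 * B / r)))).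
  apply: (le_trans (rnormD _ _)); apply: lerD.
    by apply: (le_trans (rnorm_scalar_mx _ _)).
  apply: (le_trans (rnorm_mulmx _ _)); apply: ler_pM => //; last exact: rnorm_ge0.
  by rewrite mulr_ge0 ?rnorm_ge0.
rewrite /= exprS; set t := 6 * Q / r; set e := (1 + t) ^+ size s.
have e1 : 1 <= e by apply: exprn_ege1; rewrite lerDl.
have -> : Q * (e * (6 * B / r)) = t * e * B by rewrite /t; field; rewrite gt_eqF.
by have := ler_wpM2r B0 e1; lra.
Qed.

End Interpolation.

(** * The primary matrix function through interpolation *)

Section MatrixFunction.
Variable R : realType.
Local Notation C := (cplx R).
Implicit Types (f g h : C -> C) (mu lam nu u z : C) (r B Q : R) (s S : seq C) (p q : {poly C}).

(** Convergence at one point of modulus [e / 2] bounds the terms there, hence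
    gives a geometric majorant at radius [e / 4]. *)
Lemma analytic_expands (Omega : set C) f w : analytic_on Omega f -> Omega w ->
  exists r B, 0 < r /\ expands w r B f.
Proof.
move=> fO /fO[a] /nbhs_rnormP[e e0 ae'].
have ae z : rnorm (z - w) < e -> \sum_(l < n) a l * (z - w) ^+ l @[n --> \oo] --> f z.
  by move=> /ae'; rewrite seriesEord.
have e4 : 0 <= e / 4 by lra.
pose u : C := toC (e / 2).
have ue : rnorm u = e / 2 by rewrite rnorm_toC //; lra.
have uw : rnorm ((w + u) - w) < e by rewrite addrAC subrr add0r ue; lra.
have u_lim := ae _ uw; rewrite addrAC subrr add0r in u_lim.
have t_lim : a n * u ^+ n @[n --> \oo] --> (0 : C).
  have d : \sum_(l < n.+1) a l * u ^+ l - \sum_(l < n) a l * u ^+ l @[n --> \oo]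
      --> f (w + u) - f (w + u) by apply: cvgB (cvg_succ u_lim) u_lim.
  rewrite subrr in d; apply: cvg_eqn d => n.
  by rewrite big_ord_recr /= addrAC subrr add0r.
move/cvg_rnormP: t_lim => /(_ _ ltr01)[n0 _ n0P].
pose K := 1 + \sum_(l < n0) rnorm (a l * u ^+ l).
have aK l : rnorm (a l) * (e / 2) ^+ l <= K.
  rewrite -ue -rnormX -rnormM /K; have [ln|nl] := ltnP l n0.
    rewrite (bigD1 (Ordinal ln)) //= addrCA lerDl addr_ge0 //.
    by apply: sumr_ge0 => i _; exact: rnorm_ge0.
  have := n0P l nl; rewrite subr0 => /ltW/le_trans; apply.
  by rewrite lerDl; apply: sumr_ge0 => i _; exact: rnorm_ge0.
have K0 : 0 <= K by apply: le_trans (aK 0%N); rewrite mulr_ge0 ?rnorm_ge0 // exprn_ge0 //; lra.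
exists (e / 4), (2 * K); split; first by lra.
exists a; split=> [n|z zr]; last by apply: ae; lra.
(* the exact value of the geometric sum *)
have : weighted a (e / 4) n <= K * (2 - 2^-1 ^+ n * 2).
  elim: n => [|n IH]; first by rewrite /weighted big_ord0 expr0; lra.
  have q0 : 0 <= 2^-1 ^+ n :> R by rewrite exprn_ge0.
  have e42 : (e / 4) ^+ n = (e / 2) ^+ n * 2^-1 ^+ n by rewrite -exprMn; congr (_ ^+ _); field.
  by rewrite weightedS exprS e42; have := ler_wpM2r q0 (aK n); lra.
move/le_trans; apply.
have : 0 <= K * (2^-1 ^+ n * 2) by rewrite !mulr_ge0 // exprn_ge0.
by lra.
Qed.

Lemma minpoly_split n (X : 'M[C]_n.+1) : exists s : seq C,
  mxminpoly X = \prod_(lam <- s) ('X - lam%:P).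
Proof.
have [s ->] := closed_field_poly_normal (mxminpoly X).
by exists s; rewrite (monicP (mxminpoly_monic X)) scale1r.
Qed.

Lemma hermite_interpolant_unique f n (X : 'M[C]_n.+1) q1 q2 :
  hermite_interpolant f X q1 -> hermite_interpolant f X q2 -> q1 = q2.
Proof.
have [s Xs] := minpoly_split X.
move=> [s1 d1] [s2 d2]; apply/subr0_eq/(@derivn_eq0 _ _ s) => [|z k].
  rewrite -ltnS; have <- : size (mxminpoly X) = (size s).+1 by rewrite Xs size_prod_XsubC.
  by apply: leq_ltn_trans (size_polyD _ _) _; rewrite size_polyN gtn_max s1.
rewrite -(mu_prod_XsubC z s) -Xs => kz.
by rewrite derivnB !hornerE d1 // d2 // subrr.
Qed.

(** Any polynomial that agrees with [f] up to a smooth multiple of the minimal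
    polynomial computes the matrix function; this shows at the same time that
    the Hermite interpolant exists. *)
Lemma matfun_interpolant (U : set C) s f h n (X : 'M[C]_n.+1) p :
  mxminpoly X = \prod_(lam <- s) ('X - lam%:P) -> open U ->
  (forall lam, lam \in s -> U lam) -> smooth_on U h ->
  (forall z, U z -> f z = p.[z] + \prod_(lam <- s) (z - lam) * h z) ->
  matfun f X = horner_mx X p.
Proof.
move=> Xs oU sU hU fE.
pose q := p %% mxminpoly X; pose k z := (p %/ mxminpoly X).[z] + h z.
have m0 : mxminpoly X != 0 by rewrite monic_neq0 // mxminpoly_monic.
have pE : p = (p %/ mxminpoly X) * mxminpoly X + q := divp_eq p _.
have kU : smooth_on U k.
  move=> j z Uz.
  have hd := smooth_is_derive j hU Uz.
  have pd := smooth_is_derive j (@smooth_horner _ U (p %/ mxminpoly X)) Uz.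
  have [d _] := is_deriveD pd hd.
  apply: near_eq_derivable d; apply: (open_near oU Uz) => w Uw.
  by rewrite (derive1n_add oU (@smooth_horner _ U (p %/ mxminpoly X)) hU j Uw).
have fE' z : U z -> f z = q.[z] + \prod_(lam <- s) (z - lam) * k z.
  move=> Uz; rewrite fE // [in LHS]pE Xs !hornerE horner_prod.
  rewrite (eq_bigr (fun lam => z - lam)); last by move=> lam _; rewrite !hornerE.
  by rewrite /k Xs; ring.
have qH : hermite_interpolant f X q.
  split; first by rewrite ltn_modp.
  move=> z j; rewrite Xs mu_prod_XsubC => jz.
  have Uz : U z.
    by apply: sU; rewrite -has_pred1 has_count; apply: leq_trans jz.
  exact: (derive1n_interpolant oU kU fE' Uz jz).
rewrite /matfun.
have xH : hermite_interpolant f X (xget 0 [set q | hermite_interpolant f X q]).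
  exact: (@xgetI _ _ [set q | hermite_interpolant f X q] q qH).
rewrite (hermite_interpolant_unique xH qH) [in RHS]pE rmorphD rmorphM /=.
by rewrite mx_root_minpoly mulr0 add0r.
Qed.

(** Polynomials have a second-order expansion at every matrix, with the
    derivative given by the noncommutative product rule. *)
Lemma horner_mx_quadratic n (X : 'M[C]_n.+1) p :
  exists (L : 'M[C]_n.+1 -> 'M[C]_n.+1) (K : R),
  [/\ linear L, 0 <= K, forall E, rnorm (L E) <= K * rnorm E &
    forall E, rnorm E <= 1 ->
      rnorm (horner_mx (X + E) p - horner_mx X p - L E) <= K * rnorm E ^+ 2].
Proof.
elim/poly_ind: p => [|p c [L [K [linL K0 LK pK]]]].
  exists (fun=> 0), 0; split=> // [a u v|E|E _]; first by rewrite scaler0 addr0.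
    by rewrite rnorm0 mul0r.
  by rewrite !rmorph0 !subr0 rnorm0 mul0r.
set F := horner_mx X p in pK; set N : R := n.+1%:R.
have N0 : 0 <= N by [].
pose T := rnorm F + K * rnorm X + K + K * (rnorm X + 1).
have [X0 F0] := (rnorm_ge0 X, rnorm_ge0 F).
have KX : 0 <= K * rnorm X by apply: mulr_ge0.
exists (fun E => L E *m X + F *m E), (N * T).
split=> [a u v||E|E E1].
- rewrite linL mulmxDl mulmxDr scalerDr -!scalemxAl -!scalemxAr.
  by rewrite addrACA.
- by rewrite mulr_ge0 // /T; lra.
- apply: (le_trans (rnormD _ _)).
  have h1 := rnorm_mulmx (L E) X; have h2 := rnorm_mulmx F E.
  have E0 := rnorm_ge0 E.
  have h3 : N * rnorm (L E) * rnorm X <= N * (K * rnorm E) * rnorm X.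
    by rewrite ler_wpM2r // ler_wpM2l.
  have h4 : 0 <= N * (K + K * (rnorm X + 1)) * rnorm E by rewrite !mulr_ge0 //; lra.
  by move: h1 h2 h3 h4; rewrite -/N /T; lra.
have E0 := rnorm_ge0 E.
have hE := pK E E1; set rho := _ - _ - _ in hE.
have -> : horner_mx (X + E) (p * 'X + c%:P) - horner_mx X (p * 'X + c%:P) -
    (L E *m X + F *m E) = L E *m E + rho *m (X + E).
  rewrite !rmorphD !rmorphM /= !horner_mx_C !horner_mx_X -!mulmxE -/F /rho.
  rewrite !mulmxBl !mulmxDr.
  set a1 := _ *m X; set a2 := _ *m E; set a3 := F *m X; set a4 := F *m E.
  set a5 := L E *m X; set a6 := L E *m E; clearbody a1 a2 a3 a4 a5 a6.
  by apply/matrixP => i j; rewrite !mxE; ring.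
apply: (le_trans (rnormD _ _)).
have h1 := rnorm_mulmx (L E) E; have h2 := rnorm_mulmx rho (X + E).
have h3 : N * rnorm (L E) * rnorm E <= N * (K * rnorm E) * rnorm E.
  by rewrite ler_wpM2r // ler_wpM2l.
have h4 : N * rnorm rho * rnorm (X + E) <= N * (K * rnorm E ^+ 2) * (rnorm X + 1).
  apply: ler_pM; rewrite ?mulr_ge0 ?rnorm_ge0 //; first by rewrite ler_wpM2l.
  by apply: (le_trans (rnormD _ _)); rewrite lerD2l.
have h5 : 0 <= N * (rnorm F + K * rnorm X) * rnorm E ^+ 2.
  by rewrite !mulr_ge0 ?exprn_ge0 // addr_ge0.
by move: h1 h2 h3 h4 h5; rewrite -/N /T !expr2; lra.
Qed.

End MatrixFunction.

(** * Eigenvalues of nearby matrices *)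

Section Estimate.
Variable R : realType.
Local Notation C := (cplx R).
Implicit Types (f g h : C -> C) (mu lam nu u z : C) (r B Q : R) (s S : seq C) (p q : {poly C}).

Lemma eigenvalue_horner_bound n (X : 'M[C]_n.+1) p lam : eigenvalue X lam ->
  rnorm p.[lam] <= n.+1%:R * rnorm (horner_mx X p).
Proof.
move=> /eigenvalueP[v vX v0].
have vp : v *m horner_mx X p = p.[lam] *: v.
  elim/poly_ind: p => [|p c IH]; first by rewrite rmorph0 mulmx0 horner0 scale0r.
  rewrite rmorphD rmorphM /= horner_mx_C horner_mx_X -mulmxE mulmxDr mulmxA IH.
  by rewrite -scalemxAl vX mul_mx_scalar scalerA -scalerDl !hornerE.
have vn0 : 0 < rnorm v by rewrite rnorm_gt0.
rewrite -(ler_pM2r vn0) -rnormZ -vp mulrAC; exact: rnorm_mulmx.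
Qed.

(** If all factors were larger than [rho], so would be their geometric mean. *)
Lemma near_root s lam (rho : R) : 0 <= rho ->
  rnorm (\prod_(mu <- s) (lam - mu)) < rho ^+ size s ->
  exists2 mu, mu \in s & rnorm (lam - mu) <= rho.
Proof.
move=> rho0; elim: s => [|mu s IH]; first by rewrite big_nil rnorm1 expr0 ltxx.
rewrite big_cons rnormM /= exprS => lt_prod.
have [lam_mu|rho_lt] := leP (rnorm (lam - mu)) rho; first by exists mu; rewrite ?mem_head.
have [|nu nus lam_nu] := IH; last by exists nu; rewrite // inE nus orbT.
rewrite ltNge; apply/negP => ge_prod; move: lt_prod; rewrite ltNge => /negP; apply.
by apply: ler_pM; rewrite ?exprn_ge0 // ltW.
Qed.

Lemma nth_root (a : R) n : 0 <= a -> (0 < n)%N -> exists2 x, 0 <= x & x ^+ n = a.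
Proof.
move=> a0 n0; exists (rnorm (n.-root (toC a))); first exact: rnorm_ge0.
by rewrite -rnormX rootCK // rnorm_toC.
Qed.

Lemma uniform_radius (T : eqType) (s : seq T) (P : T -> R -> Prop) :
  (forall x e e', P x e -> 0 < e' <= e -> P x e') ->
  (forall x, x \in s -> exists2 e, 0 < e & P x e) ->
  exists2 e, 0 < e & forall x, x \in s -> P x e.
Proof.
move=> P_anti; elim: s => [_|x s IH sP]; first by exists 1.
have [|e e0 eP] := IH; first by move=> y ys; apply: sP; rewrite inE ys orbT.
have [|e' e'0 e'P] := sP x; first exact: mem_head.
exists (Num.min e e'); first by rewrite lt_min e0.
move=> y; rewrite inE => /orP[/eqP->|/eP ye].
  by apply: P_anti e'P _; rewrite lt_min e0 e'0 ge_min lexx orbT.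
by apply: P_anti ye _; rewrite lt_min e0 e'0 ge_min lexx.
Qed.

Lemma expands_prod mu r B h s : 0 <= r -> expands mu r B h ->
  expands mu r (\prod_(lam <- s) (rnorm (mu - lam) + r) * B)
    (fun z => \prod_(lam <- s) (z - lam) * h z).
Proof.
move=> r0 hE; elim: s => [|lam s IH].
  rewrite big_nil mul1r; apply: expands_ext hE => z _; by rewrite big_nil mul1r.
rewrite big_cons -mulrA; apply: expands_ext (expands_mul lam r0 IH) => z _.
by rewrite big_cons mulrA.
Qed.

(** Only the factor of [mu] itself is small; it contributes the power of [r]. *)
Lemma prod_dist_le S mu r (w : R) : mu \in S -> 0 <= r <= 1 ->
  (forall lam, lam \in S -> rnorm (mu - lam) + 1 <= w) ->
  \prod_(lam <- S) (rnorm (mu - lam) + r) <= r * w ^+ size S.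
Proof.
move=> muS /andP[r0 r1] Sw.
have fac0 lam : 0 <= rnorm (mu - lam) + r by rewrite addr_ge0 ?rnorm_ge0.
have w1 : 1 <= w by have := Sw _ muS; have := rnorm_ge0 (mu - mu); lra.
elim: S muS Sw => // lam S IH muS Sw; rewrite big_cons /= exprS.
have Sw' nu : nu \in S -> rnorm (mu - nu) + 1 <= w.
  by move=> nuS; apply: Sw; rewrite inE nuS orbT.
have lam_w : rnorm (mu - lam) + r <= w.
  by have := Sw _ (mem_head lam S); lra.
have [lam_mu|lam_mu] := eqVneq lam mu.
  rewrite lam_mu subrr rnorm0 add0r; apply: ler_wpM2l => //.
  have : \prod_(j <- S) (rnorm (mu - j) + r) <= w ^+ size S.
    elim: S Sw' {IH muS Sw} => [|nu S IH] Sw'; first by rewrite big_nil expr0.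
    rewrite big_cons /= exprS; apply: ler_pM => //; first exact: prodr_ge0.
      by have := Sw' _ (mem_head nu S); lra.
    by apply: IH => k kS; apply: Sw'; rewrite inE kS orbT.
  by move/le_trans; apply; rewrite ler_peMl // exprn_ge0 //; lra.
rewrite mulrCA; apply: ler_pM => //; first exact: prodr_ge0.
by apply: IH => //; move: muS; rewrite inE eq_sym (negPf lam_mu).
Qed.

Lemma prod_repeat (F : C -> R) S k :
  \prod_(lam <- flatten (nseq k S)) F lam = (\prod_(lam <- S) F lam) ^+ k.
Proof.
elim: k => [|k IH]; first by rewrite big_nil expr0.
by rewrite /= big_cat IH exprS.
Qed.

End Estimate.

(** * Second-order approximation of the matrix function *)

Section Near.
Variable R : realType.
Local Notation C := (cplx R).
Implicit Types (f g h : C -> C) (mu lam nu u z : C) (r B Q : R) (s S : seq C) (p q : {poly C}).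

(** An eigenvalue [lam] of [X] satisfies [chi lam = O(rnorm (chi X))] for the
    characteristic polynomial [chi] of [M], and [chi X = O(rnorm (X - M))] by
    Cayley-Hamilton. Hence, up to a constant, eigenvalues move by at most the
    [N]-th root of the perturbation, [N] being the size of the matrix. *)
Lemma spectrum_near n (M : 'M[C]_n.+1) ms : char_poly M = \prod_(mu <- ms) ('X - mu%:P) ->
  exists2 kap : R, 0 < kap & forall X (x : R) lam, 0 < x -> eigenvalue X lam ->
    rnorm (X - M) <= 1 -> kap * rnorm (X - M) <= x ^+ n.+1 ->
    exists2 mu, mu \in ms & rnorm (lam - mu) <= x.
Proof.
move=> Mms; have [L [K [_ K0 LK pK]]] := horner_mx_quadratic M (char_poly M).
have ms_size : size ms = n.+1.
  by have := size_char_poly M; rewrite Mms size_prod_XsubC => -[].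
set N : R := n.+1%:R; have N0 : 0 <= N by [].
exists (N * (2 * K) + 1) => [|X x lam x0 Xlam XM1 XMx].
  by rewrite ltr_wpDl // !mulr_ge0.
apply: near_root; first exact: ltW.
rewrite ms_size; have [XM|XM] := eqVneq X M.
  have : root (char_poly M) lam by rewrite -eigenvalue_root_char -XM.
  rewrite Mms => /rootP; rewrite horner_prod (eq_bigr (fun mu => lam - mu)); last first.
    by move=> mu _; rewrite !hornerE.
  by move=> ->; rewrite rnorm0 exprn_gt0.
have d0 : 0 < rnorm (X - M) by rewrite rnorm_gt0 subr_eq0.
have := eigenvalue_horner_bound (char_poly M) Xlam; rewrite {1}Mms horner_prod.
rewrite (eq_bigr (fun mu => lam - mu)) => [hX|mu _]; last by rewrite !hornerE.
apply: le_lt_trans hX _; apply: lt_le_trans XMx.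
have := pK (X - M) XM1; rewrite addrCA subrr addr0 Cayley_Hamilton subr0 => hX.
have h1 : rnorm (horner_mx X (char_poly M)) <= 2 * K * rnorm (X - M).
  rewrite -[horner_mx X _](subrK (L (X - M))); apply: (le_trans (rnormD _ _)).
  have := LK (X - M).
  have : K * rnorm (X - M) ^+ 2 <= K * rnorm (X - M).
    by rewrite ler_wpM2l // expr2 ler_piMl // rnorm_ge0.
  lra.
have := ler_wpM2l N0 h1; rewrite -/N; lra.
Qed.

(** The heart of the matter: near [M] the matrix function is a fixed polynomial
    up to an error of second order. The polynomial interpolates [f] at the
    spectrum of [M] to the order [3N], where [N] is the size of [M], so that on
    discs of radius [r] the difference is [O(r ^+ (3 * N))]. If [r ^+ N] is
    proportional to [t], all matrices at distance [t] from [M] have their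
    spectrum well inside these discs, and interpolating the difference there
    loses a factor [1 / r] for each of at most [N] nodes: what remains is
    [O(r ^+ (2 * N)) = O(t ^+ 2)]. *)
Lemma matfun_near n (M : 'M[C]_n.+1) f (Omega : set C) : analytic_on Omega f ->
  (forall z, eigenvalue M z -> Omega z) ->
  exists q (K del : R), 0 < del /\ forall (t : R) X, 0 < t <= del -> rnorm (X - M) <= t ->
    rnorm (matfun f X - horner_mx X q) <= K * t ^+ 2.
Proof.
move=> fO specO; set N := n.+1.
have [ms Mms] := closed_field_poly_normal (char_poly M).
rewrite (monicP (char_poly_monic M)) scale1r in Mms.
pose S := undup ms.
have S_eig mu : mu \in S -> eigenvalue M mu.
  by rewrite mem_undup eigenvalue_root_char Mms root_prod_XsubC.
have msS mu : mu \in ms -> mu \in S by rewrite mem_undup.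
have [r1 r10 r1P] : exists2 r, 0 < r & forall mu, mu \in S -> exists B, expands mu r B f.
  apply: uniform_radius => [mu r r' [B fE] rr|mu /S_eig/specO/(analytic_expands fO)].
    by exists B; apply: expands_radius fE; case/andP: rr => /ltW -> ->.
  by move=> [r [B [r0 fE]]]; exists r => //; exists B.
have [r2 r20 r2P] : exists2 r, 0 < r &
    forall mn, mn \in [seq (mu, nu) | mu <- S, nu <- S] -> mn.1 != mn.2 ->
      3 * r <= rnorm (mn.1 - mn.2).
  apply: uniform_radius => [mn r r' hr /andP[r'0 rr] mn_neq|mn _].
    by have := hr mn_neq; lra.
  have [->|mn_neq] := eqVneq mn.1 mn.2; first by exists 1.
  exists (rnorm (mn.1 - mn.2) / 3); last by move=> _; lra.
  by rewrite divr_gt0 // rnorm_gt0 subr_eq0.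
have [B0 B0P] : exists B, forall mu, mu \in S -> expands mu r1 B f.
  (* a common bound, obtained as the inverse of a common small number *)
  have [b b0 bP] : exists2 b, 0 < b & forall mu, mu \in S -> expands mu r1 b^-1 f.
    apply: uniform_radius => [mu b b' fE /andP[b'0 bb]|mu /r1P[B fE]].
      by apply: expands_le fE; rewrite lef_pV2 // posrE // (lt_le_trans b'0).
    exists (B + 1)^-1; first by rewrite invr_gt0 ltr_wpDl // (expands_bound0 fE).
    by rewrite invrK; apply: expands_le fE; rewrite lerDl.
  by exists b^-1.
have Bp : 0 <= Num.max 0 B0 by rewrite le_max lexx.
pose r0 := Num.min 1 (Num.min r1 r2).
have r00 : 0 < r0 by rewrite !lt_min r10 r20 ltr01.
have [r0_1 r0_r1 r0_r2] : [/\ r0 <= 1, r0 <= r1 & r0 <= r2].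
  by rewrite /r0 !ge_min !lexx !orbT.
have sep r : 0 < r <= r0 ->
    forall mu nu, mu \in S -> nu \in S -> mu != nu -> 3 * r <= rnorm (mu - nu).
  move=> /andP[rp rr] mu nu muS nuS mn.
  by have := r2P (mu, nu) (allpairs_f pair muS nuS) mn; rewrite /=; lra.
(* N nodes will be lost to interpolation at nearby spectra, 2N make t ^+ 2 *)
pose s0 := flatten (nseq (3 * N) S).
have s0S lam : lam \in s0 -> lam \in S.
  by move=> /flattenP[s1]; rewrite mem_nseq => /andP[_ /eqP->].
have [|lam||mu muS|q [h [fE [B1 hS] _]]] := @newton R S r0 s0 (Num.max 0 B0) f r00.
- by apply: sep; rewrite r00 lexx.
- by move=> /s0S lamS; exists lam => //; rewrite subrr rnorm0 divr_ge0 // ltW.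
- exact: Bp.
- apply: (expands_radius (r := r1)); first by rewrite ltW.
  by apply: expands_le (B0P _ muS); rewrite le_max lexx orbT.
have B10 : 0 <= Num.max 0 B1 by rewrite le_max lexx.
pose g z := \prod_(lam <- s0) (z - lam) * h z.
pose W : R := \sum_(mu <- S) rnorm mu.
have SW mu : mu \in S -> rnorm mu <= W.
  move=> muS; rewrite /W (big_rem mu) //= lerDl.
  by apply: sumr_ge0 => nu _; exact: rnorm_ge0.
have W0 : 0 <= W by apply: sumr_ge0 => nu _; exact: rnorm_ge0.
pose w := 2 * W + 1.
pose a := w ^+ size S.
have a0 : 0 <= a by rewrite exprn_ge0 // /w; lra.
have gS r : 0 < r <= r0 -> forall mu, mu \in S ->
    expands mu r ((r * a) ^+ (3 * N) * Num.max 0 B1) g.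
  move=> /andP[rp rr] mu muS.
  have hE : expands mu r (Num.max 0 B1) h.
    apply: (expands_radius (r := r0)); first by rewrite ltW.
    by apply: expands_le (hS _ muS); rewrite le_max lexx orbT.
  apply: expands_le (expands_prod s0 (ltW rp) hE); apply: ler_wpM2r => //.
  rewrite prod_repeat; apply: lerXn2r.
  - by rewrite nnegrE prodr_ge0 // => lam _; rewrite addr_ge0 ?rnorm_ge0 // ltW.
  - by rewrite nnegrE mulr_ge0 // ltW.
  apply: prod_dist_le => //; first by rewrite (ltW rp) (le_trans rr).
  move=> lam lamS; have := rnormB mu lam; have := SW _ lamS; have := SW _ muS.
  rewrite /w; lra.
have [kap kap0 near_ms] := spectrum_near Mms.
pose Q : R := N%:R * (rnorm M + 1 + (W + 1)).
have Q0 : 0 <= Q by rewrite mulr_ge0 // !addr_ge0 ?rnorm_ge0.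
(* so that the radius [r] chosen below stays below [r0] *)
pose del := Num.min 1 ((r0 / 2) ^+ N / kap).
have del0 : 0 < del by rewrite lt_min ltr01 divr_gt0 ?exprn_gt0 // divr_gt0.
exists q, ((1 + 6 * Q) ^+ N * a ^+ (3 * N) * (2 ^+ N * kap) ^+ 2 * Num.max 0 B1), del.
split=> // t X /andP[t0]; rewrite le_min ler_pdivlMr // => /andP[t1 t_r0] XMt.
have [x x0 xt] : exists2 x, 0 <= x & x ^+ N = kap * t.
  by apply: nth_root => //; rewrite mulr_ge0 // ltW.
have xp : 0 < x.
  rewrite lt_def x0 andbT; apply/eqP => x_0; move: xt; rewrite x_0 expr0n /= => /esym/eqP.
  by rewrite mulf_eq0 !gt_eqF.
pose r := 2 * x.
have rp : 0 < r by rewrite mulr_gt0.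
have rr0 : r <= r0.
  have : x <= r0 / 2.
    have r02 : 0 <= r0 / 2 by lra.
    by rewrite -(@ler_pXn2r _ N) ?nnegrE // xt [kap * t]mulrC.
  by rewrite /r; lra.
have [s Xs] := minpoly_split X.
have s_near lam : lam \in s -> exists2 mu, mu \in S & rnorm (lam - mu) <= r / 2.
  move=> lams; have Xlam : eigenvalue X lam by rewrite eigenvalue_root_min Xs root_prod_XsubC.
  have [||mu mums lam_mu] := near_ms X x lam xp Xlam.
  - by apply: le_trans t1.
  - by rewrite -/N xt ler_pM2l.
  by exists mu; [exact: msS | rewrite /r; lra].
have s_size : (size s <= N)%N.
  rewrite -ltnS -(size_char_poly X).
  have <- : size (mxminpoly X) = (size s).+1 by rewrite Xs size_prod_XsubC.
  apply: dvdp_leq; last exact: mxminpoly_dvd_char.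
  by rewrite -size_poly_gt0 size_char_poly.
have rr : 0 < r <= r0 by rewrite rp.
have [|p [k [gE [B' kS] pX]]] := newton rp (sep r rr) s_near _ (gS r rr).
  by rewrite mulr_ge0 // exprn_ge0 // mulr_ge0 // ltW.
pose U : set C := [set z | exists2 mu, mu \in S & rnorm (z - mu) < r].
have oU : open U.
  rewrite openE => z [mu muS zmu]; apply/nbhs_rnormP.
  exists (r - rnorm (z - mu)) => [|y yz]; first by rewrite subr_gt0.
  exists mu => //; have -> : y - mu = (y - z) + (z - mu) by ring.
  by apply: (le_lt_trans (rnormD _ _)); lra.
have sU lam : lam \in s -> U lam.
  by move=> /s_near[mu muS lam_mu]; exists mu => //; lra.
have kU : smooth_on U k.
  by move=> j z [mu muS zmu]; apply: (expands_smooth (kS _ muS)); exact: zmu.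
have fE' z : U z -> f z = (q + p).[z] + \prod_(lam <- s) (z - lam) * k z.
  by move=> _; rewrite hornerD -addrA -gE fE.
rewrite (matfun_interpolant Xs oU sU kU fE') rmorphD addrAC subrr add0r.
apply: le_trans (pX _ X Q Q0 _) _.
  move=> lam lams; apply: ler_wpM2l => //; apply: lerD.
    by rewrite -[X](subrK M) addrC; apply: (le_trans (rnormD _ _)); lra.
  have [mu muS lam_mu] := s_near _ lams.
  rewrite -[lam](subrK mu) addrC; apply: (le_trans (rnormD _ _)).
  by have := SW _ muS; lra.
rewrite mulrA [leRHS]mulrAC; apply: ler_wpM2r => //.
have rN : r ^+ N = 2 ^+ N * kap * t by rewrite /r exprMn xt mulrA.
have -> : (1 + 6 * Q) ^+ N * a ^+ (3 * N) * (2 ^+ N * kap) ^+ 2 * t ^+ 2 =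
    ((1 + 6 * Q) / r) ^+ N * (r * a) ^+ (3 * N).
  have r_neq0 : r ^+ N != 0 by rewrite expf_neq0 // gt_eqF.
  rewrite [(r * a) ^+ _]exprMn.
  have -> : r ^+ (3 * N) = r ^+ N * (r ^+ N) ^+ 2 by rewrite -exprS -exprM mulnC.
  rewrite expr_div_n -[LHS]mulrA.
  have -> : (2 ^+ N * kap) ^+ 2 * t ^+ 2 = (r ^+ N) ^+ 2 by rewrite rN [RHS]exprMn.
  by move: (r ^+ N) r_neq0 => b b0; field.
apply: ler_wpM2r; first by rewrite exprn_ge0 // mulr_ge0 // ltW.
have r1' : r <= 1 by apply: le_trans r0_1.
have base : 1 + 6 * Q / r <= (1 + 6 * Q) / r.
  by rewrite ler_pdivlMr // mulrDl mul1r divfK ?gt_eqF // lerD2r.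
have base1 : 1 <= 1 + 6 * Q / r.
  have : 0 <= 6 * Q / r by apply: divr_ge0; [exact: mulr_ge0 | exact: ltW].
  lra.
apply: (@le_trans _ _ ((1 + 6 * Q / r) ^+ N)); first by apply: ler_weXn2l.
have base0 : 0 <= 1 + 6 * Q / r := le_trans ler01 base1.
by apply: lerXn2r; rewrite // nnegrE ?(le_trans base0).
Qed.
End Near.

(** * Frechet derivatives *)

Section Differential.
Variable R : realType.
Local Notation C := (cplx R).

(** The bound on [L] makes it continuous. A quadratic remainder is more than
    differentiability asks for; it is what the estimates give. *)
Definition second_order (V W : normedModType C) (F : V -> W) x (L : V -> W) := exists K del : R,
  [/\ 0 < del, forall E, rnorm (L E) <= K * rnorm E &
    forall E, rnorm E <= del -> rnorm (F (E + x) - F x - L E) <= K * rnorm E ^+ 2].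

Lemma diff_second_order (V W : normedModType C) (F : V -> W) x (L : V -> W) :
  linear L -> second_order F x L -> 'd F x = L :> (V -> W).
Proof.
move=> linL [K [del [del0 LK FK]]].
pose L' : {linear V -> W} := HB.pack L (GRing.isLinear.Build _ _ _ _ L linL).
have K1 : 0 < `|K| + 1 by rewrite ltr_wpDl.
have KK : K <= `|K| + 1 by have := ler_norm K; lra.
apply: (@diff_unique _ V W F L' x).
  move=> y; apply/cvg_rnormP => e e0; apply/nbhs_rnormP.
  exists (e / (`|K| + 1)); first by rewrite divr_gt0.
  move=> z; rewrite ltr_pdivlMr // => zy.
  rewrite /= -[L z - L y]/(L' z - L' y) -linearB; apply: (le_lt_trans (LK _)).
  apply: le_lt_trans zy; rewrite mulrC; apply: ler_wpM2l KK; exact: rnorm_ge0.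
apply/eqaddoP => _ /posC_toC[e e0 ->].
apply/nbhs_rnormP; exists (Num.min del (e / (`|K| + 1))).
  by rewrite lt_min del0 divr_gt0.
move=> E; rewrite subr0 lt_min ltr_pdivlMr // => /andP[/ltW Edel Ee].
rewrite !normE -toCM toC_le /=.
have -> : (F \o shift x - (cst (F x) + L' : V -> W)) E = F (E + x) - F x - L E.
  by rewrite /GRing.add /= /GRing.opp /= opprD addrA.
apply: (le_trans (FK E Edel)); have E0 := rnorm_ge0 E.
rewrite expr2 mulrA; apply: ler_wpM2r => //; rewrite mulrC.
by apply: le_trans (ltW Ee); apply: ler_wpM2l.
Qed.

(** The error of [matfun_near] is needed twice, at [M + E] and at [M], both times
    with [t] the norm of [E]. *)
Lemma matfun_second_order n (M : 'M[C]_n) (f : C -> C) (Omega : set C) : analytic_on Omega f ->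
  (forall z, eigenvalue M z -> Omega z) ->
  exists2 L : 'M[C]_n -> 'M[C]_n, linear L & second_order (@matfun R f n) M L.
Proof.
case: n M => [|n] M fO specO.
  exists id => //; exists 1, 1; split=> // E; first by rewrite mul1r.
  by rewrite /matfun addrK subrr rnorm0 mul1r sqr_ge0.
have [q [K [del [del0 near_q]]]] := matfun_near fO specO.
have [L [K' [linL K'0 LK' qK']]] := horner_mx_quadratic M q.
exists L => //; exists (2 * `|K| + K'), (Num.min 1 del).
have KK := ler_norm K; have K0 := normr_ge0 K.
split=> [|E|E]; first by rewrite lt_min ltr01.
  by apply: (le_trans (LK' E)); apply: ler_wpM2r; [exact: rnorm_ge0 | lra].
rewrite le_min => /andP[E1 Edel].
have [->|E0] := eqVneq E 0.
  have -> : L 0 = 0 by have := LK' 0; rewrite rnorm0 mulr0 => h;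
    apply/eqP; rewrite -rnorm_eq0 eq_le h rnorm_ge0.
  by rewrite add0r subrr subr0 rnorm0 expr0n mulr0.
rewrite [E + M]addrC.
have En : 0 < rnorm E <= del by rewrite rnorm_gt0 E0.
have h1 : rnorm (matfun f (M + E) - horner_mx (M + E) q) <= K * rnorm E ^+ 2.
  by apply: near_q => //; rewrite addrAC subrr add0r.
have h2 : rnorm (matfun f M - horner_mx M q) <= K * rnorm E ^+ 2.
  by apply: near_q => //; rewrite subrr rnorm0 rnorm_ge0.
have h3 := qK' E E1.
have h4 : K * rnorm E ^+ 2 <= `|K| * rnorm E ^+ 2 by rewrite ler_wpM2r ?sqr_ge0.
set a1 := matfun f _ in h1 *; set a2 := horner_mx _ q in h1 h3.
set a3 := matfun f M in h2 *; set a4 := horner_mx M q in h2 h3.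
have -> : a1 - a3 - L E = (a1 - a2) - (a3 - a4) + (a2 - a4 - L E).
  by apply/matrixP => i j; rewrite !mxE; ring.
apply: (le_trans (rnormD _ _)); have := rnormB (a1 - a2) (a3 - a4); lra.
Qed.

Lemma bcirc_linear n p : linear (@bcirc C n n p).
Proof. by move=> a A B; apply/matrixP => x y; rewrite !mxE. Qed.

Lemma rnorm_bcirc n p (A : tensor C n n p) : rnorm (bcirc A) <= rnorm A.
Proof.
apply: rnorm_mx_le => [|x y]; first exact: rnorm_ge0.
by rewrite !mxE; apply: rnorm_mx_entry.
Qed.

(** The chain rule, for the linear maps [bcirc] and multiplication by [E1]. *)
Lemma tfun_second_order n p (A : tensor C n n p) (f : C -> C) L :
  linear L -> second_order (@matfun R f (p * n)) (bcirc A) L ->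
  linear (fun E => L (bcirc E) *m E1 C n p) /\
  second_order (@tfun R f n p) A (fun E => L (bcirc E) *m E1 C n p).
Proof.
move=> linL [K [del [del0 LK fK]]].
have bcircD E : bcirc (E + A) = bcirc E + bcirc A.
  by have := bcirc_linear 1 E A; rewrite !scale1r.
split=> [a u v|]; first by rewrite bcirc_linear linL mulmxDl -scalemxAl.
set e := rnorm (E1 C n p).
set N : R := (p * n)%:R.
have c0 : 0 <= N * e by rewrite mulr_ge0 ?rnorm_ge0.
have mulE1 (Y : 'M[C]_(p * n)) : rnorm (Y *m E1 C n p) <= N * e * rnorm Y.
  by apply: (le_trans (rnorm_mulmx Y _)); rewrite mulrAC.
exists (N * e * `|K|), del; split=> [//|E|E Edel].
  apply: (le_trans (mulE1 _)); rewrite -[leRHS]mulrA; apply: ler_wpM2l => //.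
  apply: (le_trans (LK _)); apply: (@le_trans _ _ (`|K| * rnorm (bcirc E))).
    by apply: ler_wpM2r; [exact: rnorm_ge0 | exact: ler_norm].
  by apply: ler_wpM2l => //; exact: rnorm_bcirc.
rewrite /tfun bcircD -!mulmxBl; apply: (le_trans (mulE1 _)).
rewrite -[leRHS]mulrA; apply: ler_wpM2l => //.
have bE := rnorm_bcirc E.
apply: (le_trans (fK _ (le_trans bE Edel))).
apply: (@le_trans _ _ (`|K| * rnorm (bcirc E) ^+ 2)).
  by apply: ler_wpM2r; [exact: sqr_ge0 | exact: ler_norm].
by apply: ler_wpM2l => //; apply: lerXn2r; rewrite // nnegrE rnorm_ge0.
Qed.

End Differential.

(** * Block circulants of unit tensors and the column indices *)

Section Indices.
Variable R : realType.
Local Notation C := (cplx R).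

Lemma entryE m n (M : 'M[C]_(m, n)) (x : 'I_m) (y : 'I_n) : entry M x.+1 y.+1 = M x y.
Proof. by rewrite /entry !valK. Qed.

Lemma mulmx_vec_delta a b m (K : 'M[C]_(m, b * a)) (i : 'I_a) (j : 'I_b) x :
  (K *m vec (delta_mx i j)) x ord0 = K x (mxtens_index (j, i)).
Proof.
rewrite mxE (bigD1 (mxtens_index (j, i))) //= big1 => [|y yne].
  by rewrite addr0 !mxE mxtens_indexK !eqxx mulr1.
rewrite !mxE; case: (altP andP) => [[/eqP e1 /eqP e2]|_]; last by rewrite mulr0.
by rewrite -(mxtens_unindexK y) -e1 -e2 -surjective_pairing eqxx in yne.
Qed.

Definition ord_addmod (p : nat) (r s : 'I_p) : 'I_p :=
  Ordinal (ltn_pmod (r + s) (leq_ltn_trans (leq0n r) (ltn_ord r))).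

Lemma ord_submod_eq p (a b k : 'I_p) : (ord_submod a b == k) = (a == ord_addmod k b).
Proof.
rewrite -!val_eqE /=; case: a b k => a ap [b bp] [k kp] /=.
have [h|h] := leqP p (k + b).
  have -> : ((k + b) %% p = k + b - p)%N by rewrite -[in LHS](subnK h) modnDr modn_small //; lia.
  have [h'|h'] := leqP p (a + (p - b)).
    have -> : ((a + (p - b)) %% p = a + (p - b) - p)%N.
      by rewrite -[in LHS](subnK h') modnDr modn_small //; lia.
    by apply/eqP/eqP; lia.
  by rewrite modn_small //; apply/eqP/eqP; lia.
rewrite [((k + b) %% p)%N]modn_small //.
have [h'|h'] := leqP p (a + (p - b)).
  have -> : ((a + (p - b)) %% p = a + (p - b) - p)%N.
    by rewrite -[in LHS](subnK h') modnDr modn_small //; lia.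
  by apply/eqP/eqP; lia.
by rewrite modn_small //; apply/eqP/eqP; lia.
Qed.

(** The circulant pattern repeats the single entry of a unit tensor once in each
    block column [b], in block row [k + b] modulo [p]; this is where the [p]
    columns of the sum come from. *)
Lemma bcirc_delta n p (k : 'I_p) (i j : 'I_n) :
  bcirc (delta_mx (mxtens_index (k, i)) j : tensor C n n p) =
  \sum_(b < p) delta_mx (mxtens_index (ord_addmod k b, i)) (mxtens_index (b, j)).
Proof.
apply/matrixP => x y; rewrite -(mxtens_unindexK x) -(mxtens_unindexK y).
move: (mxtens_unindex x) (mxtens_unindex y) => [a i'] [b j'].
rewrite !mxE !mxtens_indexK /= (can_eq (@mxtens_indexK _ _)) summxE.
rewrite (bigD1 b) //= big1 => [|b' bb].
  rewrite addr0 mxE !(can_eq (@mxtens_indexK _ _)) !xpair_eqE eqxx /= ord_submod_eq.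
  by [].
by rewrite mxE !(can_eq (@mxtens_indexK _ _)) !xpair_eqE [b == b']eq_sym (negPf bb) /= andbF.
Qed.

(** Multiplication by [E1] keeps the first block column, so that vectorizing the
    product gives the initial segment of the vectorized matrix. *)
Lemma mulmx_E1 n p (Y : 'M[C]_(p * n)) (i : 'I_(p * n)) (j : 'I_n) (b0 : 'I_p) :
  val b0 = 0%N -> (Y *m E1 C n p) i j = Y i (mxtens_index (b0, j)).
Proof.
move=> b00; rewrite mxE (bigD1 (mxtens_index (b0, j))) //= big1 => [|y yne].
  by rewrite addr0 mxE mxtens_indexK /= b00 !eqxx mulr1.
rewrite mxE; case: (altP andP) => [[/eqP e1 /eqP e2]|_]; last by rewrite mulr0.
case/negP: yne; rewrite -(mxtens_unindexK y) (can_eq (@mxtens_indexK _ _)) -e2.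
by rewrite [X in X == _]surjective_pairing xpair_eqE eqxx andbT; apply/eqP/val_inj; rewrite b00 -e1.
Qed.

(** Solving the recursion for the shift: each step moves one block column to the
    right and one block row down, except for the single step at which the block
    row index wraps around from [p - 1] to [0]. Here [b] and [k.-1] count from
    [0]. The equation is additive because subtraction is truncated. *)
Lemma col_shift_closed n p k b : (0 < n)%N -> (0 < k <= p)%N -> (b < p)%N ->
  (col_shift n p k b.+1 + (p <= k.-1 + b) * (n * p) = b * (n ^ 2 * p + n))%N.
Proof.
move=> n0 kp; elim: b => [|b IH] bp.
  have -> : (p <= k.-1 + 0)%N = false by lia.
  by [].
have {}IH := IH (ltnW bp).
have n2 : (n * p <= n ^ 2 * p)%N by rewrite leq_mul2r -mulnn leq_pmulr ?orbT.
have -> : col_shift n p k b.+2 = if b.+2 == (p - k + 2)%N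
           then (col_shift n p k b.+1 + n ^ 2 * p - n * p + n)%N
           else (col_shift n p k b.+1 + n ^ 2 * p + n)%N by [].
move: IH; set x := col_shift n p k b.+1; set y := (n ^ 2 * p)%N in n2 *.
set w := (n * p)%N in n2 *; move=> IH.
have [h|h] := eqVneq; have [h1|h1] := leqP p (k.-1 + b); have [h2|h2] := leqP p (k.-1 + b.+1).
all: rewrite ?h1 ?h2 /= in IH *; lia.
Qed.

End Indices.

(** * The column formula *)

Theorem lemma4 (R : realType) (n p : nat) (A : tensor (cplx R) n n p)
  (f : cplx R -> cplx R) (Omega : set (cplx R))
  (Omega_open : open Omega)
  (f_analytic : analytic_on Omega f)
  (spectrum_sub : forall z : cplx R, eigenvalue (bcirc A) z -> Omega z)
  (K1 : 'M[cplx R]_(n * (p * n)))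
  (K1_def : kronecker_form (@tfun R f n p) A K1)
  (K2 : 'M[cplx R]_((p * n) * (p * n)))
  (K2_def : kronecker_form (@matfun R f (p * n)) (bcirc A) K2)
  (i j k : nat)
  (i_range : (1 <= i <= n)%N) (j_range : (1 <= j <= n)%N)
  (k_range : (1 <= k <= p)%N) :
  let c := (i + (k - 1) * n + (j - 1) * n * p)%N in
  forall r : nat, (1 <= r <= n ^ 2 * p)%N ->
    entry K1 r c =
      \sum_(1 <= alpha < p.+1) entry K2 r (c + col_shift n p k alpha)%N.
Proof.
move=> c r r_range.
have [L linL LM] := matfun_second_order f_analytic spectrum_sub.
have [linT LT] := tfun_second_order linL LM.
have dM := diff_second_order linL LM; have dT := diff_second_order linT LT.
have [[n0 p0] [i_lt j_lt k_lt]] : (0 < n /\ 0 < p)%N /\ [/\ i.-1 < n, j.-1 < n & k.-1 < p]%N.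
  by split; [split|split]; lia.
pose i0 := Ordinal i_lt; pose j0 := Ordinal j_lt; pose k0 := Ordinal k_lt.
pose b0 := Ordinal p0.
have r_lt : (r.-1 < n * (p * n))%N.
  have -> : (n * (p * n) = n ^ 2 * p)%N by rewrite mulnCA mulnC mulnn.
  lia.
pose x := Ordinal r_lt.
have [[u v] xE] : exists uv, x = mxtens_index uv.
  by exists (mxtens_unindex x); rewrite mxtens_unindexK.
pose x' := mxtens_index (mxtens_index (b0, u), v).
pose y := mxtens_index (j0, mxtens_index (k0, i0)).
pose y' b := mxtens_index (mxtens_index (b, j0), mxtens_index (ord_addmod k0 b, i0)).
have rx : r = x.+1 by rewrite /= prednK //; lia.
(* positions count from 1 in the statement, ordinals from 0 *)
have cy : c = y.+1.
  rewrite /c /y /=; case: (i) i_range (j) j_range (k) k_range => // i' _ [] // j' _ [] // k' _.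
  by rewrite !subn1 /=; lia.
have x'x : x' = x :> nat by rewrite xE /x' /= mul0n add0n.
have y'c b : (c + col_shift n p k (b : 'I_p).+1)%N = (y' b).+1.
  have b_lt := ltn_ord b.
  have := col_shift_closed n0 k_range b_lt.
  move: (col_shift n p k b.+1) => s; rewrite cy /y /y' /=.
  have -> : (n ^ 2 * p = n * (p * n))%N by rewrite mulnCA mulnC mulnn.
  have e1 : ((b * n + j.-1) * (p * n) = b * (n * (p * n)) + j.-1 * (p * n))%N.
    by rewrite mulnDl -mulnA.
  have [h|h] := leqP p (k.-1 + b).
    have -> : ((k.-1 + b) %% p = k.-1 + b - p)%N.
      by rewrite -[in LHS](subnK h) modnDr modn_small //; lia.
    have e2 : ((k.-1 + b - p) * n + n * p = k.-1 * n + b * n)%N.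
      by rewrite [(n * p)%N]mulnC -mulnDl subnK // mulnDl.
    by rewrite e1 mulnDr mul1n; lia.
  by rewrite modn_small // e1 mulnDl mulnDr mul0n; lia.
rewrite big_add1 big_mkord rx.
under eq_bigr => b _ do rewrite y'c -x'x entryE.
rewrite cy entryE -mulmx_vec_delta -K1_def mxE xE mxtens_indexK /= dT.
rewrite (@mulmx_E1 _ _ _ _ _ _ b0) // -dM bcirc_delta linear_sum summxE.
apply: eq_bigr => b _.
by rewrite /y' -[RHS]mulmx_vec_delta -K2_def mxE mxtens_indexK.
Qed.
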